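(* Let $w=(w_k)_{k\ge0}$ be a weight sequence with $w_0>0$ and $w_k>0$ for some $k\ge1$. Suppose that $n\to\infty$ and $m=m(n)$ with $m/n\to\lambda$, where $0<\lambda<\omega$, and let $\tau$ be the unique number in $[0,\rho]$ with $\Psi(\tau)=\lambda$ if $\lambda\le\nu$, and $\tau=\rho$ if $\lambda>\nu$. If $\rho>0$, then for every fixed $k\in\mathbb Z$ with $\mathrm{span}(w)\mid k$, $$\frac{Z(m+k,n)}{Z(m,n)}\to\tau^{-k}.$$
   Context: A weight sequence is a sequence $w=(w_k)_{k\ge0}$ of nonnegative reals; $\omega=\sup\{k:w_k>0\}$; $\mathrm{span}(w)$ is the largest $d\ge1$ dividing every $k$ with $w_k>0$. $\Phi(t)=\sum_kw_kt^k$, $\rho$ its radius of convergence; $\Psi(t)=t\Phi'(t)/\Phi(t)$ for $\Phi(t)<\infty$, $\Psi(\rho)=\lim_{t\uparrow\rho}\Psi(t)$ if $\Phi(\rho)=\infty$; $\nu=\Psi(\rho)$. $Z(m,n)=\sum\prod_{i=1}^nw_{y_i}$ over all $(y_1,\dots,y_n)\in\{0,1,\dots\}^n$ with $\sum y_i=m$ (and $Z(m,n)=0$ if $m<0$); the limit is along $n$ with $Z(m,n)>0$. *)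

(* Defs.v *)
From Stdlib Require Import Reals ZArith ClassicalEpsilon.
From Coquelicot Require Import Coquelicot.
From mathcomp Require Import ssreflect ssrfun ssrbool eqtype ssrnat seq fintype finfun bigop ssralg.
From mathcomp Require Import Rstruct.

Set Implicit Arguments.
Unset Strict Implicit.

Definition weight_seq (w : nat -> R) : Prop := forall k, (0 <= w k)%R.

Definition omega_w (w : nat -> R) : Rbar :=
  Lub_Rbar (fun x => exists k : nat, x = INR k /\ (0 < w k)%R).

Definition is_span (w : nat -> R) (d : nat) : Prop :=
  (1 <= d)%coq_nat /\ (forall k, (0 < w k)%R -> Nat.divide d k) /\
  (forall d', (1 <= d')%coq_nat -> (forall k, (0 < w k)%R -> Nat.divide d' k) ->
              (d' <= d)%coq_nat).

Definition Phi (w : nat -> R) (t : R) : R := PSeries w t.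
Definition rho_w (w : nat -> R) : Rbar := CV_radius w.

Definition Psi (w : nat -> R) (t : R) : R := (t * Derive (Phi w) t / Phi w t)%R.

Definition Rbar_lim_along (F : (R -> Prop) -> Prop) (f : R -> R) : Rbar :=
  epsilon (inhabits p_infty) (fun l => filterlim f F (Rbar_locally l)).

(** Phi'(rho) = sum_{k>=1} k w_k rho^(k-1), a sum of nonnegative terms in [0, +oo]. *)
Definition PhiD_bar (w : nat -> R) (r : R) : Rbar :=
  Lim_seq (sum_n (fun k => (INR (S k) * w (S k) * r ^ k)%R)).

Definition nu_w (w : nat -> R) : Rbar :=
  match rho_w w with
  | Rbar.Finite r =>
      if excluded_middle_informative (ex_series (fun k => (w k * r ^ k)%R))
      then Rbar_mult (Rbar_mult (Rbar.Finite r) (PhiD_bar w r)) (Rbar.Finite (/ Phi w r))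
      else Rbar_lim_along (at_left r) (Psi w)
  | Rbar.p_infty => Rbar_lim_along (Rbar_locally p_infty) (Psi w)
  | Rbar.m_infty => m_infty
  end.

Definition Psi_ext (w : nat -> R) (t : R) : Rbar :=
  if Rbar_lt_dec (Rbar.Finite t) (rho_w w) then Rbar.Finite (Psi w t) else nu_w w.

(** Z(m,n) = sum over (y_1..y_n) in N^n with sum y_i = m of prod w_{y_i}.
    (Each y_i <= m automatically, so tuples range over 'I_(m+1).) *)
Definition Zmn (w : nat -> R) (m n : nat) : R :=
  (\sum_(y : {ffun 'I_n -> 'I_m.+1} | (\sum_(i < n) (y i : nat))%N == m)
      \prod_(i < n) w (y i))%R.

Definition Zw (w : nat -> R) (m : Z) (n : nat) : R :=
  if (m <? 0)%Z then 0%R else Zmn w (Z.to_nat m) n.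

(* Main.v *)
Require Import Defs.
From Stdlib Require Import Reals ZArith Lra Lia Classical ClassicalEpsilon.
From Coquelicot Require Import Coquelicot.
From mathcomp Require ssreflect ssrfun ssrbool eqtype ssrnat seq fintype finfun bigop ssralg ssrnum poly Rstruct.

(** Let [c] be the minimum of [Phi(t) t^(-lambda)], attained at [tau]. Every
    [Z(m,n)] with [m] near [lambda n] is [c^n] up to a factor [e^(o(n))]. The upper bound is
    [Z(m,n) t^m <= Phi(t)^n]; for the lower bound, a line separating the point
    [(lambda, ln c - eps)] from the points [(M/b, ln Z(M,b) / b)] would have a slope
    [-ln t] with [Phi(t) t^(-lambda) < c], so by supermultiplicativity of [Z] the point is
    reached by mixing two configurations. Changing the single weight [w_j] into
    [w_j e^s] and applying Jensen's inequality then shows that the mean proportion of boxes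
    with [j] balls, [w_j Z(m-j,n-1) / Z(m,n)], tends to [w_j tau^j / Phi(tau)].
    Dividing by the case [j = 0] gives [Z(m-j,n) / Z(m,n) -> tau^j] for [j] in the
    support of [w], and the shifts [k] for which the theorem holds form a subgroup. *)

(** * Z(m,n) as a coefficient in the n-th power of a polynomial *)

Section PolynomialCoefficients.
Import ssreflect ssrfun ssrbool eqtype ssrnat seq fintype finfun bigop ssralg ssrnum poly Rstruct.
Import GRing.Theory Num.Theory.
Local Open Scope ring_scope.
Implicit Types (w : nat -> R) (m n : nat).

(** The hypotheses give no second moment at [tau], and for lambda > nu the minimum sits at the
    boundary [tau] = rho, so Z(m,n) is estimated only on the exponential scale. That is enough
    because the tilt s stays fixed while n grows: the error e^(o(n)) becomes o(n) / (s n) in the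
    mean proportion of boxes, and s is made small afterwards. Both signs of s are used, one for each
    side of the limit. At the boundary the tilted mean may be smaller than lambda; then only values
    t > rho could contradict the minimality of c, and there the partial sums of Phi are unbounded.
    All estimates are uniform over the pairs (m,n) with m near lambda n, since the ratios are later
    composed with shifts of both arguments. *)

Lemma sum_f_R0_bigE (f : nat -> R) n : sum_f_R0 f n = \sum_(i < n.+1) f i.
Proof.
elim: n => [|n IH]; first by rewrite big_ord1.
by rewrite big_ord_recr /= -IH.
Qed.

Lemma Zmn_coef w m n : Zmn w m n = ((\poly_(k < m.+1) w k) ^+ n)`_m.
Proof.
have -> : (\poly_(k < m.+1) w k) ^+ n
    = \prod_(i < n) \sum_(k < m.+1) (w k *: 'X^k : {poly R}).
  by rewrite prodr_const card_ord poly_def.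
rewrite bigA_distr_bigA coef_sum /Zmn big_mkcond /=.
apply: eq_bigr => y _.
rewrite scaler_prod -expr_sum coefZ coefXn eq_sym.
by case: eqP => _; rewrite ?mulr1 ?mulr0.
Qed.

Lemma coef_expS (p : {poly R}) m n :
  (p ^+ n.+1)`_m = \sum_(j < m.+1) p`_j * (p ^+ n)`_(m - j).
Proof. by rewrite exprS coefM. Qed.

(** The polynomial in [Zmn_coef] is truncated at a degree that moves with [m]. Higher terms cannot
    reach the coefficient at [m], so truncations at different degrees may be exchanged in the
    recursion [Zmn_S]. *)
Lemma coef_exp_local (p q : {poly R}) n m :
  (forall k, (k <= m)%N -> p`_k = q`_k) -> (p ^+ n)`_m = (q ^+ n)`_m.
Proof.
elim: n m => [|n IH] m pq; first by rewrite !expr0.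
rewrite !coef_expS; apply: eq_bigr => j _.
rewrite pq ?IH //; last by rewrite -ltnS.
by move=> k km; rewrite pq // (leq_trans km) // leq_subr.
Qed.

Lemma Zmn_0 w m : Zmn w m 0 = if Nat.eqb m 0 then IZR (Zpos xH) else IZR Z0.
Proof. by rewrite Zmn_coef expr0 coef1; case: m. Qed.

Lemma Zmn_S w m n :
  Zmn w m n.+1 = sum_f_R0 (fun j => Rmult (w j) (Zmn w (Nat.sub m j) n)) m.
Proof.
rewrite sum_f_R0_bigE Zmn_coef coef_expS; apply: eq_bigr => j _.
rewrite coef_poly ltn_ord Zmn_coef RmultE minusE; congr (_ * _).
apply: coef_exp_local => k km.
by rewrite !coef_poly !ltnS km (leq_trans km (leq_subr _ _)).
Qed.

(** The n-th power of the truncated series has degree at most [K * n], and truncation only removes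
    nonnegative contributions to its coefficients. The number of terms on the right is linear in [n]
    and will disappear under an n-th root. *)
Lemma pow_partial_sum_le w t K n : weight_seq w -> Rle 0 t ->
  Rle (pow (sum_f_R0 (fun k => Rmult (w k) (pow t k)) K) n)
      (sum_f_R0 (fun M => Rmult (Zmn w M n) (pow t M)) (Nat.mul K n)).
Proof.
move=> w0 /RleP t0; apply/RleP.
have w0' k : 0 <= w k by apply/RleP.
pose p := \poly_(k < K.+1) w k.
have pE : sum_f_R0 (fun k => Rmult (w k) (pow t k)) K = p.[t].
  by rewrite sum_f_R0_bigE horner_poly; apply: eq_bigr => k _; rewrite RmultE RpowE.
have p0 i : 0 <= p`_i by rewrite coef_poly; case: ifP.
have pn0 n' i : 0 <= (p ^+ n')`_i.
  elim: n' i => [|n' IH] i; first by rewrite expr0 coef1 ler0n.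
  by rewrite coef_expS sumr_ge0 // => j _; rewrite mulr_ge0.
have pZ n' i : (p ^+ n')`_i <= Zmn w i n'.
  elim: n' i => [|n' IH] i; first by rewrite Zmn_coef !expr0.
  rewrite Zmn_S sum_f_R0_bigE coef_expS; apply: ler_sum => j _.
  rewrite RmultE; apply: ler_pM => //.
  by rewrite coef_poly; case: ifP.
rewrite pE RpowE -horner_exp sum_f_R0_bigE.
rewrite (@horner_coef_wide _ (K * n).+1); last first.
  rewrite (leq_trans (size_poly_exp_leq _ _)) // ltnS leq_mul2r orbC.
  by case: (size p) (size_poly K.+1 w) => // s /=; rewrite ltnS => ->.
apply: ler_sum => i _; rewrite RmultE RpowE; apply: ler_pM => //.
by rewrite exprn_ge0.
Qed.

(** [Psi] is defined with the mathcomp ring operations; this is its form in the Stdlib operations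
    that [field] and [lra] handle. *)
Lemma Psi_E w t : Psi w t = Rdiv (Rmult t (Derive (Phi w) t)) (Phi w t).
Proof. by rewrite /Psi RdivE RmultE. Qed.

End PolynomialCoefficients.

Local Open Scope R_scope.

(** * Supermultiplicativity, upper bounds and exponential moments of the occupancy count *)

Section Convolution.
Variable w : nat -> R.
Hypothesis w_ge0 : weight_seq w.

Lemma Zmn_ge0 m n : 0 <= Zmn w m n.
Proof.
revert m; induction n as [|n IH]; intros m.
- rewrite Zmn_0; destruct (Nat.eqb m 0%nat); lra.
- rewrite Zmn_S; apply cond_pos_sum; intros j.
  apply Rmult_le_pos; [apply w_ge0 | apply IH].
Qed.

Lemma sum_f_R0_zero_tail (f : nat -> R) N p :
  (forall i, (N < i <= N + p)%nat -> f i = 0) ->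
  sum_f_R0 f (N + p) = sum_f_R0 f N.
Proof.
induction p as [|p IH]; intros f0; [now rewrite Nat.add_0_r|].
rewrite Nat.add_succ_r; simpl; rewrite IH, f0; [lra | lia | intros; apply f0; lia].
Qed.

Lemma sum_f_R0_delta (c : R) j m :
  sum_f_R0 (fun i => if Nat.eqb i j then c else 0) m =
  if Nat.leb j m then c else 0.
Proof.
induction m as [|m IH].
- destruct j; reflexivity.
- rewrite tech5, IH.
  destruct (Nat.eqb_spec (S m) j); destruct (Nat.leb_spec j m);
    destruct (Nat.leb_spec j (S m)); try lia; lra.
Qed.

Lemma sum_f_R0_term_le (f : nat -> R) j m :
  (forall i, 0 <= f i) -> (j <= m)%nat -> f j <= sum_f_R0 f m.
Proof.
intros f0 jm; induction jm as [|m jm IH].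
- destruct j; simpl; [lra|]; pose proof (cond_pos_sum f j f0); lra.
- simpl; pose proof (f0 (S m)); lra.
Qed.

Lemma sum_f_R0_incr (f : nat -> R) j m :
  (forall i, 0 <= f i) -> (j <= m)%nat -> sum_f_R0 f j <= sum_f_R0 f m.
Proof.
intros f0 jm; induction jm as [|m jm IH]; [lra|].
simpl; pose proof (f0 (S m)); lra.
Qed.

Lemma Zmn_1 k : Zmn w k 1 = w k.
Proof.
rewrite Zmn_S, (sum_eq _ (fun i => if Nat.eqb i k then w k else 0)).
- rewrite sum_f_R0_delta, Nat.leb_refl; reflexivity.
- intros i ik; rewrite Zmn_0.
  destruct (Nat.eqb_spec (k - i) 0%nat); destruct (Nat.eqb_spec i k);
    subst; try lia; ring.
Qed.

(** Two allocations placed side by side form an allocation of the joint system. In the recursion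
    over the first box, the terms with [j > m1] are dropped. *)
Lemma Zmn_supermul m1 n1 m2 n2 :
  Zmn w m1 n1 * Zmn w m2 n2 <= Zmn w (m1 + m2) (n1 + n2).
Proof.
revert m1; induction n1 as [|n1 IH]; intros m1.
- rewrite Zmn_0; destruct (Nat.eqb_spec m1 0%nat) as [->|_]; simpl; [lra|].
  rewrite Rmult_0_l; apply Zmn_ge0.
- change (S n1 + n2)%nat with (S (n1 + n2)); rewrite !Zmn_S, Rmult_comm, scal_sum.
  set (f := fun j => w j * Zmn w (m1 + m2 - j) (n1 + n2)).
  apply Rle_trans with (sum_f_R0 f m1).
  + apply sum_Rle; intros j jm; unfold f.
    rewrite Rmult_assoc; apply Rmult_le_compat_l; [apply w_ge0|].
    replace (m1 + m2 - j)%nat with (m1 - j + m2)%nat by lia; apply IH.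
  + apply sum_f_R0_incr; [|lia].
    intros j; apply Rmult_le_pos; [apply w_ge0 | apply Zmn_ge0].
Qed.

Lemma Zmn_pow_le m n a : Zmn w m n ^ a <= Zmn w (a * m) (a * n).
Proof.
induction a as [|a IH]; simpl.
- rewrite Zmn_0; simpl; lra.
- eapply Rle_trans; [|apply Zmn_supermul].
  apply Rmult_le_compat_l; [apply Zmn_ge0 | exact IH].
Qed.

(** The left side is one of the nonnegative terms of Phi(t)^n. Asking only for a bound [B] on
    partial sums lets the lemma apply directly to modified weights. *)
Lemma Zmn_upper t B m n : 0 <= t ->
  (forall K, sum_f_R0 (fun k => w k * t ^ k) K <= B) ->
  Zmn w m n * t ^ m <= B ^ n.
Proof.
intros t0 hB.
assert (B0 : 0 <= B).
{ eapply Rle_trans; [|apply (hB 0%nat)]; simpl; pose proof (w_ge0 0%nat); lra. }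
revert m; induction n as [|n IH]; intros m.
- rewrite Zmn_0; destruct (Nat.eqb_spec m 0%nat) as [->|_]; simpl; lra.
- rewrite Zmn_S, Rmult_comm, scal_sum; simpl pow.
  eapply Rle_trans; [|apply Rmult_le_compat_r; [apply pow_le, B0 | apply (hB m)]].
  rewrite Rmult_comm, scal_sum; apply sum_Rle; intros j jm.
  replace (t ^ m) with (t ^ j * t ^ (m - j)) by (rewrite <- pow_add; f_equal; lia).
  replace (_ * _ * _) with ((w j * t ^ j) * (Zmn w (m - j) n * t ^ (m - j))) by ring.
  apply Rmult_le_compat_l; [|apply IH].
  apply Rmult_le_pos; [apply w_ge0 | apply pow_le, t0].
Qed.

Lemma Zmn_divide d m n :
  (forall k, 0 < w k -> Nat.divide d k) -> 0 < Zmn w m n -> Nat.divide d m.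
Proof.
intros hd; revert m; induction n as [|n IH]; intros m.
- rewrite Zmn_0; destruct (Nat.eqb_spec m 0%nat) as [->|_]; [|lra].
  intros _; apply Nat.divide_0_r.
- rewrite Zmn_S; intros hs.
  destruct (classic (Nat.divide d m)) as [|nd]; [assumption|].
  rewrite sum_eq_R0 in hs; [lra|]; intros j jm.
  destruct (Rle_lt_or_eq_dec _ _ (w_ge0 j)) as [wj|<-]; [|lra].
  destruct (Rle_lt_or_eq_dec _ _ (Zmn_ge0 (m - j) n)) as [zj|<-]; [|lra].
  exfalso; apply nd; replace m with (j + (m - j))%nat by lia.
  apply Nat.divide_add_r; auto.
Qed.

(** [occupancy j m n] is the total weight of the allocations of [m] balls in
    [n] boxes, each multiplied by its number of boxes with exactly [j] balls. *)
Definition occupancy j m n : R :=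
  INR n * (if Nat.leb j m then w j * Zmn w (m - j) (n - 1) else 0).

(** Splits off the first box, which is counted exactly when it holds [j] balls. The factor [n] in
    the closed form reflects the exchangeability of the boxes. *)
Lemma occupancy_S j m n :
  occupancy j m (S n) =
  sum_f_R0 (fun i => w i * occupancy j (m - i) n
                     + (if Nat.eqb i j then w j * Zmn w (m - j) n else 0)) m.
Proof.
rewrite sum_plus, sum_f_R0_delta; unfold occupancy.
rewrite S_INR; replace (S n - 1)%nat with n by lia.
destruct (Nat.leb_spec j m) as [jm|jm].
- rewrite Rmult_plus_distr_r, Rmult_1_l; f_equal.
  destruct n as [|n].
  + simpl INR; rewrite Rmult_0_l; symmetry; apply sum_eq_R0; intros; ring.
  + replace (S n - 1)%nat with n by lia.
    replace m with (m - j + j)%nat at 2 by lia.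
    rewrite sum_f_R0_zero_tail.
    * rewrite Zmn_S, <- Rmult_assoc, scal_sum; apply sum_eq; intros i im.
      destruct (Nat.leb_spec j (m - i)); [|lia].
      replace (m - j - i)%nat with (m - i - j)%nat by lia; ring.
    * intros i im; destruct (Nat.leb_spec j (m - i)); [lia | ring].
- rewrite sum_eq_R0; [ring|]; intros i im.
  destruct (Nat.leb_spec j (m - i)); [lia | ring].
Qed.

(** With these weights [Zmn] is the sum of exp (s N) over all allocations, N being the number of
    boxes with exactly [j] balls: an unnormalised moment generating function of N. *)
Definition reweight j s k : R := if Nat.eqb k j then exp s * w k else w k.

Lemma reweight_ge0 j s : weight_seq (reweight j s).
Proof.
intros k; unfold reweight; pose proof (exp_pos s); pose proof (w_ge0 k).
destruct (Nat.eqb k j); [apply Rmult_le_pos; lra | lra].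
Qed.

(* The tangent at [E] to [N |-> exp (s * N)], summed over all allocations with
   [N] their number of boxes with exactly [j] balls. *)
Lemma reweight_tangent j s E m n :
  exp (s * E) * (Zmn w m n * (1 - s * E) + s * occupancy j m n)
  <= Zmn (reweight j s) m n.
Proof.
revert E m; induction n as [|n IH]; intros E m.
- unfold occupancy; simpl INR; rewrite !Zmn_0.
  destruct (Nat.eqb m 0%nat); [|lra].
  pose proof (exp_pos (s * E)) as e0; pose proof (exp_ineq1_le (- (s * E))) as e1.
  rewrite exp_Ropp in e1.
  apply (Rmult_le_compat_l (exp (s * E))) in e1; [|lra].
  rewrite Rinv_r in e1; lra.
- rewrite occupancy_S, !Zmn_S.
  rewrite (Rmult_comm (sum_f_R0 _ m)), !scal_sum, <- sum_plus, scal_sum.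
  apply sum_Rle; intros i im; unfold reweight at 1.
  destruct (Nat.eqb_spec i j) as [->|ij].
  (* A first box with [j] balls already adds one to the count, so the tangent for the other boxes is
     taken at [E - 1]. *)
  + apply Rle_trans with (exp s * w j * (exp (s * (E - 1)) *
      (Zmn w (m - j) n * (1 - s * (E - 1)) + s * occupancy j (m - j) n))).
    * assert (exp (s * E) = exp s * exp (s * (E - 1))) as ->
        by (rewrite <- exp_plus; f_equal; ring).
      apply Req_le; ring.
    * apply Rmult_le_compat_l; [|apply IH].
      apply Rmult_le_pos; [apply Rlt_le, exp_pos | apply w_ge0].
  + apply Rle_trans with (w i * (exp (s * E) *
      (Zmn w (m - i) n * (1 - s * E) + s * occupancy j (m - i) n))).
    * apply Req_le; ring.
    * apply Rmult_le_compat_l; [apply w_ge0 | apply IH].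
Qed.

(** When [E] is the mean count, the linear term of the tangent cancels. *)
Lemma reweight_jensen j s m n : 0 < Zmn w m n ->
  exp (s * (occupancy j m n / Zmn w m n)) * Zmn w m n <= Zmn (reweight j s) m n.
Proof.
intros z0; eapply Rle_trans; [|apply (reweight_tangent j s (occupancy j m n / Zmn w m n))].
apply Req_le; field; lra.
Qed.

Lemma sum_reweight_le j s t B : 0 <= t ->
  (forall K, sum_f_R0 (fun k => w k * t ^ k) K <= B) ->
  forall K, sum_f_R0 (fun k => reweight j s k * t ^ k) K
            <= B + (exp s - 1) * (w j * t ^ j).
Proof.
intros t0 hB K.
assert (h0 : forall k, 0 <= reweight j s k * t ^ k).
{ intros k; apply Rmult_le_pos; [apply reweight_ge0 | apply pow_le, t0]. }
(* For [s < 0] the correction is negative, so the partial sum is first extended far enough to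
   contain the altered term. *)
eapply Rle_trans; [apply (sum_f_R0_incr _ K (Nat.max K j)); [exact h0 | lia]|].
rewrite (sum_eq _ (fun k => w k * t ^ k
   + (if Nat.eqb k j then (exp s - 1) * (w j * t ^ j) else 0))).
- rewrite sum_plus, sum_f_R0_delta; pose proof (hB (Nat.max K j)).
  destruct (Nat.leb_spec j (Nat.max K j)); [lra | lia].
- intros k _; unfold reweight; destruct (Nat.eqb_spec k j) as [->|]; ring.
Qed.

Lemma pow_le_exp x n : 0 <= 1 + x -> (1 + x) ^ n <= exp (INR n * x).
Proof.
intros x0; induction n as [|n IH]; [simpl; rewrite Rmult_0_l, exp_0; lra|].
rewrite S_INR; simpl pow.
replace ((INR n + 1) * x) with (x + INR n * x) by ring; rewrite exp_plus.
apply Rmult_le_compat; [lra | apply pow_le, x0 | | exact IH].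
apply exp_ineq1_le.
Qed.

End Convolution.

(** Jensen's inequality below and [Zmn_upper] for the altered weights above. For [B] = Phi(t),
    [w j * t ^ j / B] is the probability of [j] under the tilted law, and the last factor is the
    Poisson bound on the moment generating function of a binomial variable. *)
Lemma occupancy_chernoff w j s t B m n : weight_seq w -> 0 <= t -> 0 < B ->
  (forall K, sum_f_R0 (fun k => w k * t ^ k) K <= B) ->
  0 < Zmn w m n ->
  exp (s * (occupancy w j m n / Zmn w m n)) * (Zmn w m n * t ^ m)
  <= B ^ n * exp (INR n * ((exp s - 1) * (w j * t ^ j / B))).
Proof.
intros w_ge0 t0 B0 hB z0.
set (x := (exp s - 1) * (w j * t ^ j / B)).
assert (wB : B + (exp s - 1) * (w j * t ^ j) = B * (1 + x)) by (unfold x; field; lra).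
pose proof (sum_reweight_le w w_ge0 j s t B t0 hB) as hB'; rewrite wB in hB'.
assert (x0 : 0 <= 1 + x).
{ apply Rmult_le_reg_l with B; [exact B0|]; rewrite Rmult_0_r.
  eapply Rle_trans; [|apply (hB' 0%nat)].
  simpl; pose proof (reweight_ge0 w w_ge0 j s 0%nat); lra. }
rewrite <- Rmult_assoc.
eapply Rle_trans;
  [apply Rmult_le_compat_r; [apply pow_le, t0 | apply (reweight_jensen w w_ge0), z0]|].
eapply Rle_trans; [apply (Zmn_upper _ (reweight_ge0 w w_ge0 j s) t _ m n t0 hB')|].
rewrite Rpow_mult_distr; apply Rmult_le_compat_l; [apply pow_le; lra|].
apply pow_le_exp, x0.
Qed.

(** * Rounding, exponentials, and the subgroup generated by the support *)

Lemma nat_above (x : R) : exists N : nat, x <= INR N.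
Proof. destruct (INR_unbounded x) as [N hN]; exists N; lra. Qed.

Lemma nat_floor (x : R) : 0 <= x -> exists a : nat, INR a <= x < INR a + 1.
Proof.
intros x0; exists (Z.to_nat (up x - 1)); destruct (archimed x) as [h1 h2].
assert (0 < up x)%Z by (apply lt_IZR; lra).
rewrite INR_IZR_INZ, Z2Nat.id, minus_IZR by lia; lra.
Qed.

Lemma exp_pow x n : exp x ^ n = exp (INR n * x).
Proof.
induction n as [|n IH]; [simpl; now rewrite Rmult_0_l, exp_0|].
rewrite S_INR; simpl pow; rewrite IH, <- exp_plus; f_equal; ring.
Qed.

Lemma exp_monotone x y : x <= y -> exp x <= exp y.
Proof.
intros [h|h]; [apply Rlt_le, exp_increasing, h | rewrite h; apply Rle_refl].
Qed.

(** The least positive element [g] of the subgroup [U] divides all its elements, so it suffices that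
    [g] divides [d]. The set [U] is left abstract because it serves for residues modulo a support
    point and again for the shifts of the theorem. *)
Lemma span_multiple_in_subgroup w d (U : Z -> Prop) :
  is_span w d -> (exists k, (1 <= k)%nat /\ 0 < w k) ->
  (forall k, 0 < w k -> U (Z.of_nat k)) ->
  (forall a b, U a -> U b -> U (a - b)%Z) ->
  forall k, (Z.of_nat d | k)%Z -> U k.
Proof.
intros [d1 [dw dmax]] [k0 [k01 wk0]] Uw Usub.
assert (U0 : U 0%Z) by (rewrite <- (Z.sub_diag (Z.of_nat k0)); auto).
assert (Uopp : forall a, U a -> U (- a)%Z).
{ intros a Ua; rewrite <- Z.sub_0_l; auto. }
assert (Uadd : forall a b, U a -> U b -> U (a + b)%Z).
{ intros a b Ua Ub; replace (a + b)%Z with (a - - b)%Z by lia; auto. }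
assert (Umul : forall q a, U a -> U (q * a)%Z).
{ intros q a Ua; revert q; apply Z.bi_induction; [intros ? ? ->; tauto | exact U0 |].
  intros q; split; intros Uq.
  - rewrite Z.mul_succ_l; auto.
  - replace (q * a)%Z with (Z.succ q * a - a)%Z by lia; auto. }
destruct (dec_inh_nat_subset_has_unique_least_element
            (fun g => (1 <= g)%nat /\ U (Z.of_nat g))) as [g [[[g1 Ug] gmin] _]].
{ intros x; apply classic. }
{ exists k0; auto. }
assert (gU : forall a, U a -> (Z.of_nat g | a)%Z).
{ intros a Ua; apply Z.mod_divide; [lia|].
  destruct (Z.mod_pos_bound a (Z.of_nat g)) as [r0 rg]; [lia|].
  destruct (Z.eq_dec (a mod Z.of_nat g) 0) as [|r1]; [assumption|exfalso].
  assert (g <= Z.to_nat (a mod Z.of_nat g))%nat; [|lia].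
  apply gmin; split; [lia|]; rewrite Z2Nat.id by lia.
  rewrite Z.mod_eq, Z.mul_comm by lia; auto. }
assert (gd : Nat.divide g d).
(* The span is given as a largest common divisor in the order of size; the lcm is again a common
   divisor of the support, so maximality forces it to equal [d]. *)
{ assert (lcm_d : (Nat.lcm g d <= d)%nat).
  { apply dmax.
    - enough (Nat.lcm g d <> 0)%nat by lia; rewrite Nat.lcm_eq_0; lia.
    - intros k wk; apply Nat.lcm_least; [|auto].
      destruct (gU _ (Uw _ wk)) as [q hq].
      exists (Z.to_nat q); nia. }
  destruct (Nat.divide_lcm_r g d) as [q hq].
  assert (q = 1 \/ q = 0 \/ 2 <= q)%nat as [->|[->|]] by lia; [| |nia].
  - rewrite Nat.mul_1_l in hq; rewrite <- hq; apply Nat.divide_lcm_l.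
  - exfalso; assert (Nat.lcm g d = 0)%nat as h by lia; rewrite Nat.lcm_eq_0 in h; lia. }
intros k [q ->]; destruct gd as [p ->].
rewrite Nat2Z.inj_mul; auto.
Qed.

(** * Exponential lower bounds for Z(m,n) *)

Lemma pow_le_pow_exponent (c : R) a b : 0 <= c <= 1 -> (a <= b)%nat -> c ^ b <= c ^ a.
Proof.
intros hc ab; replace b with (a + (b - a))%nat by lia; rewrite pow_add.
rewrite <- (Rmult_1_r (c ^ a)) at 2.
apply Rmult_le_compat_l; [apply pow_le; lra|].
rewrite <- (pow1 (b - a)); apply pow_incr; lra.
Qed.

(* Modulo a large enough [s] in the support, every multiple of the span is a sum of
   boundedly many elements of the support, and what is left over is filled with
   boxes of content [s] and [0]. *)
Lemma Zmn_exp_lower_crude w d lam s :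
  weight_seq w -> 0 < w 0%nat -> is_span w d ->
  0 < lam -> lam < INR s -> 0 < w s ->
  exists c0 eta, exists N : nat, 0 < c0 /\ 0 < eta /\
    forall n m : nat, (N <= n)%nat -> Rabs (INR m - lam * INR n) <= eta * INR n ->
      Nat.divide d m -> c0 ^ n <= Zmn w m n.
Proof.
intros w_ge0 w0 dspan lam0 lams ws.
assert (s1 : (1 <= s)%nat).
{ destruct s; [simpl in lams; lra | lia]. }
pose (U := fun k : Z => exists L T : nat,
             0 < Zmn w T L /\ (Z.of_nat s | Z.of_nat T - k)%Z).
assert (Ud : U (Z.of_nat d)).
{ apply (span_multiple_in_subgroup w d U dspan); [now exists s | | | apply Z.divide_refl].
  - intros k wk; exists 1%nat, k; rewrite Zmn_1; split; [exact wk|].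
    rewrite Z.sub_diag; apply Z.divide_0_r.
  - intros a b [La [Ta [za [qa ha]]]] [Lb [Tb [zb [qb hb]]]].
    (* Modulo [s], subtracting [b] is the same as adding it [s - 1] times. *)
    exists (La + (s - 1) * Lb)%nat, (Ta + (s - 1) * Tb)%nat; split.
    + eapply Rlt_le_trans; [|apply Zmn_supermul, w_ge0].
      apply Rmult_lt_0_compat; [exact za|].
      eapply Rlt_le_trans; [|apply Zmn_pow_le, w_ge0]; apply pow_lt, zb.
    + exists (qa + Z.of_nat Tb - qb)%Z.
      rewrite Nat2Z.inj_add, Nat2Z.inj_mul, Nat2Z.inj_sub by lia; nia. }
destruct Ud as [L [T [zT hT]]].
set (z := Zmn w T L) in *.
set (c1 := Rmin 1 (Rmin z (Rmin (w s) (w 0%nat)))).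
assert (c1_bounds : 0 < c1 /\ c1 <= 1 /\ c1 <= z /\ c1 <= w s /\ c1 <= w 0%nat).
{ unfold c1; repeat apply Rmin_case_strong; intros; lra. }
destruct c1_bounds as [c10 [c11 [c1z [c1s c1w]]]].
assert (s0 : 0 < INR s) by lra.
destruct (nat_above (2 * INR s * INR T / lam)) as [N1 hN1].
destruct (nat_above (2 * INR s * INR s * INR L / (INR s - lam))) as [N2 hN2].
(* The product below has at most [q + n] factors, each at least [c1], with [q < s <= n]; hence the
   square, and the summand [s] in the threshold. The radius keeps m/n between lam/2 and (lam +
   s)/2. *)
exists (c1 ^ 2), (Rmin lam (INR s - lam) / 2), (N1 + N2 + s)%nat.
split; [apply pow_lt, c10|]; split.
{ apply Rdiv_lt_0_compat; [apply Rmin_case; lra | lra]. }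
intros n m hn hm [q0 ->].
assert (hnR : INR N1 <= INR n /\ INR N2 <= INR n) by (split; apply le_INR; lia).
destruct hnR as [hn1 hn2].
assert (n0 : 0 <= INR n) by apply pos_INR.
apply Rabs_le_between in hm.
assert (me : Rmin lam (INR s - lam) <= lam /\ Rmin lam (INR s - lam) <= INR s - lam)
  by (split; [apply Rmin_l | apply Rmin_r]).
assert (mlow : lam / 2 * INR n <= INR (q0 * d)) by nra.
assert (mup : INR (q0 * d) <= (lam + INR s) / 2 * INR n) by nra.
assert (sT : (s * T <= q0 * d)%nat).
{ apply INR_le; rewrite mult_INR; eapply Rle_trans; [|exact mlow].
  apply (Rmult_le_compat_l (lam / 2)) in hN1; [|lra].
  apply Rle_trans with (lam / 2 * INR N1); [|apply Rmult_le_compat_l; lra].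
  eapply Rle_trans; [|exact hN1]; apply Req_le; field; lra. }
(* Only [q0] modulo [s] matters: [q] copies of the configuration with total [T] already have the
   residue of [q0 * d], and their number stays below [s]. *)
set (q := (q0 mod s)%nat).
assert (qs : (q < s)%nat) by (apply Nat.mod_upper_bound; lia).
assert (exists a, (q0 * d = q * T + a * s)%nat) as [a ha].
{ assert ((Z.of_nat s | Z.of_nat (q0 * d) - Z.of_nat (q * T))%Z) as [x hx].
  { destruct hT as [y hy].
    exists (Z.of_nat (q0 / s) * Z.of_nat d - Z.of_nat q * y)%Z.
    assert (hq0 : (q0 = s * (q0 / s) + q)%nat) by apply Nat.div_mod_eq.
    rewrite hq0 at 1; nia. }
  exists (Z.to_nat x).
  assert (q * T <= q0 * d)%nat by nia.
  nia. }
assert (boxes : (q * L + a <= n)%nat).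
{ apply INR_le; rewrite plus_INR, mult_INR.
  assert (qL : INR q * INR L <= INR s * INR L).
  { apply Rmult_le_compat_r; [apply pos_INR | apply le_INR; lia]. }
  assert (aS : INR a * INR s <= (lam + INR s) / 2 * INR n).
  { rewrite <- mult_INR; eapply Rle_trans; [|exact mup]; apply le_INR; lia. }
  apply (Rmult_le_compat_l ((INR s - lam) / 2)) in hN2; [|lra].
  assert (sL : INR s * INR s * INR L <= (INR s - lam) / 2 * INR n).
  { apply Rle_trans with ((INR s - lam) / 2 * INR N2); [|apply Rmult_le_compat_l; lra].
    eapply Rle_trans; [|exact hN2]; apply Req_le; field; lra. }
  apply Rmult_le_reg_l with (INR s); [exact s0|].
  apply (Rmult_le_compat_l (INR s)) in qL; lra. }
assert (split3 : z ^ q * w s ^ a * w 0%nat ^ (n - (q * L + a)) <= Zmn w (q0 * d) n).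
{ replace n with (q * L + a * 1 + (n - (q * L + a)) * 1)%nat at 2 by lia.
  replace (q0 * d)%nat with (q * T + a * s + (n - (q * L + a)) * 0)%nat by lia.
  rewrite <- (Zmn_1 w s), <- (Zmn_1 w 0).
  eapply Rle_trans; [|apply Zmn_supermul, w_ge0].
  apply Rmult_le_compat.
  - apply Rmult_le_pos; apply pow_le; [lra | apply Zmn_ge0, w_ge0].
  - apply pow_le, Zmn_ge0, w_ge0.
  - eapply Rle_trans; [|apply Zmn_supermul, w_ge0].
    apply Rmult_le_compat; try (apply pow_le, Zmn_ge0, w_ge0);
      apply Zmn_pow_le, w_ge0.
  - apply Zmn_pow_le, w_ge0. }
eapply Rle_trans; [|exact split3].
rewrite <- pow_mult.
apply Rle_trans with (c1 ^ (q + a + (n - (q * L + a)))).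
- apply pow_le_pow_exponent; [lra|]. nia.
- rewrite !pow_add; apply Rmult_le_compat.
  + apply Rmult_le_pos; apply pow_le; lra.
  + apply pow_le; lra.
  + apply Rmult_le_compat; try (apply pow_le; lra); apply pow_incr; lra.
  + apply pow_incr; lra.
Qed.

(** A linear factor cannot compensate exponential growth. Bernoulli's inequality, [poly], gives only
    linear growth of a power of [x / q]; it is squared, with an even exponent, to beat the linear
    factor. *)
Lemma le_of_pow_le_linear (x q : R) (K : nat) : 0 <= x -> 0 < q ->
  (forall b, x ^ b <= INR (S (K * b)) * q ^ b) -> x <= q.
Proof.
intros x0 q0 H; apply Rnot_lt_le; intros qx.
set (h := x / q - 1).
assert (h0 : 0 < h).
{ unfold h; apply Rlt_0_minus; apply Rmult_lt_reg_r with q; [exact q0|].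
  unfold Rdiv; rewrite Rmult_assoc, Rinv_l; lra. }
destruct (nat_above ((2 * INR K + 1) / (h * h))) as [a ha].
assert (hpow : (1 + h) ^ (2 * S a) <= INR (S (K * (2 * S a)))).
{ replace (1 + h) with (x / q) by (unfold h; ring).
  unfold Rdiv; rewrite Rpow_mult_distr, pow_inv.
  apply Rmult_le_reg_r with (q ^ (2 * S a)); [apply pow_lt, q0|].
  rewrite Rmult_assoc, Rinv_l, Rmult_1_r; [apply H|].
  apply Rgt_not_eq, pow_lt, q0. }
pose proof (poly (S a) h h0) as hb.
rewrite Nat.mul_comm, pow_mult in hpow.
rewrite S_INR, !mult_INR, S_INR in hpow; rewrite S_INR in hb.
replace (INR 2) with 2 in hpow by (simpl; ring).
assert (hsq : (1 + (INR a + 1) * h) ^ 2 <= ((1 + h) ^ S a) ^ 2).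
{ apply pow_incr; split; [|exact hb]; pose proof (pos_INR a); nra. }
apply (Rmult_le_compat_r (h * h)) in ha; [|nra].
unfold Rdiv in ha; rewrite Rmult_assoc, Rinv_l in ha; [|nra].
pose proof (pos_INR a); pose proof (pos_INR K).
set (A := INR a + 1) in *.
assert (hA : A * A * (h * h) <= A * (2 * INR K)).
{ assert (0 < A) by (unfold A; lra). nra. }
assert (A * (h * h) <= 2 * INR K).
{ apply Rmult_le_reg_l with A; [unfold A; lra | lra]. }
unfold A in *; nra.
Qed.

(* Convex separation of the points (M/b, ln Z(M,b)/b) from the point (lam, g): without
   two such points spanning a segment above (lam, g), some line of slope -theta through
   (lam, g) lies above all of them, which bounds the b-th powers of the partial sums
   of Phi(exp theta). *)
Lemma exists_straddling_pair w lam g s :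
  weight_seq w -> 0 < w 0%nat -> 0 < lam -> lam < INR s -> 0 < w s ->
  (forall theta,
     ~ forall K, sum_f_R0 (fun k => w k * exp theta ^ k) K <= exp (g + lam * theta)) ->
  exists M1 b1 M2 b2 : nat,
    0 < Zmn w M1 b1 /\ 0 < Zmn w M2 b2 /\
    INR M1 < lam * INR b1 /\ lam * INR b2 < INR M2 /\
    0 < (ln (Zmn w M1 b1) - INR b1 * g) * (INR M2 - lam * INR b2)
        + (ln (Zmn w M2 b2) - INR b2 * g) * (lam * INR b1 - INR M1).
Proof.
intros w_ge0 w0 lam0 lams ws Hg; apply NNPP; intros Hno.
assert (H : forall M1 b1 M2 b2 : nat, 0 < Zmn w M1 b1 -> 0 < Zmn w M2 b2 ->
    INR M1 < lam * INR b1 -> lam * INR b2 < INR M2 ->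
    (ln (Zmn w M1 b1) - INR b1 * g) / (lam * INR b1 - INR M1)
    <= - ((ln (Zmn w M2 b2) - INR b2 * g) / (INR M2 - lam * INR b2))).
{ intros M1 b1 M2 b2 z1 z2 h1 h2; apply Rnot_lt_le; intros h; apply Hno.
  exists M1, b1, M2, b2; repeat split; try assumption.
  set (A := lam * INR b1 - INR M1) in *; set (D := INR M2 - lam * INR b2) in *.
  assert (A0 : 0 < A) by (unfold A; lra); assert (D0 : 0 < D) by (unfold D; lra).
  set (l1 := ln (Zmn w M1 b1) - INR b1 * g) in *.
  set (l2 := ln (Zmn w M2 b2) - INR b2 * g) in *.
  replace (l1 * D + l2 * A) with (A * D * (l1 / A + l2 / D)) by (field; lra).
  apply Rmult_lt_0_compat; [nra | lra]. }
clear Hno.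
(* [theta] is the supremum of the slopes coming from the left of [lam]. One box with [s] balls lies
   to the right and bounds them; one empty box makes the set nonempty. *)
destruct (completeness (fun u => exists M1 b1 : nat, 0 < Zmn w M1 b1 /\
    INR M1 < lam * INR b1 /\
    u = (ln (Zmn w M1 b1) - INR b1 * g) / (lam * INR b1 - INR M1)))
  as [theta [ub lub]].
{ exists (- ((ln (Zmn w s 1) - INR 1 * g) / (INR s - lam * INR 1))).
  intros u [M1 [b1 [z1 [h1 ->]]]]; apply H; try assumption.
  - now rewrite Zmn_1.
  - simpl; lra. }
{ eexists; exists 0%nat, 1%nat; rewrite Zmn_1; repeat split; [exact w0|]; simpl; lra. }
assert (below : forall M b, 0 < Zmn w M b -> INR M < lam * INR b ->
          ln (Zmn w M b) <= INR b * g + theta * (lam * INR b - INR M)).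
{ intros M b z h.
  assert (h' := ub _ (ex_intro _ M (ex_intro _ b (conj z (conj h eq_refl))))).
  apply (Rmult_le_compat_r (lam * INR b - INR M)) in h'; [|lra].
  unfold Rdiv in h'; rewrite Rmult_assoc, Rinv_l in h'; lra. }
assert (above : forall M b, 0 < Zmn w M b -> lam * INR b < INR M ->
          ln (Zmn w M b) <= INR b * g + theta * (lam * INR b - INR M)).
{ intros M b z h.
  assert (h' : theta <= - ((ln (Zmn w M b) - INR b * g) / (INR M - lam * INR b))).
  { apply lub; intros u [M1 [b1 [z1 [h1 ->]]]]; now apply H. }
  apply (Rmult_le_compat_r (INR M - lam * INR b)) in h'; [|lra].
  rewrite <- Ropp_mult_distr_l in h'.
  unfold Rdiv in h'; rewrite Rmult_assoc, Rinv_l in h'; lra. }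
assert (all : forall M b, 0 < Zmn w M b ->
          ln (Zmn w M b) <= INR b * g + theta * (lam * INR b - INR M)).
{ intros M b z; destruct (Rtotal_order (INR M) (lam * INR b)) as [h|[h|h]];
    [now apply below | | now apply above].
  (* At mean exactly [lam] no slope is defined. Adding one empty box to [k] copies moves the
     configuration to the left, and the gain [k * e] outgrows the fixed cost of that box. *)
  apply Rnot_lt_le; intros hlt.
  set (e := ln (Zmn w M b) - INR b * g) in *.
  assert (e0 : 0 < e) by (unfold e; rewrite h in hlt; lra).
  destruct (nat_above ((theta * lam + g - ln (w 0%nat)) / e + 1)) as [k hk].
  assert (zk : Zmn w M b ^ k * w 0%nat <= Zmn w (k * M + 0) (k * b + 1)).
  { rewrite <- (Zmn_1 w 0); eapply Rle_trans; [|apply Zmn_supermul, w_ge0].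
    apply Rmult_le_compat_r; [apply Zmn_ge0, w_ge0 | apply Zmn_pow_le, w_ge0]. }
  assert (zk0 : 0 < Zmn w M b ^ k * w 0%nat)
    by (apply Rmult_lt_0_compat; [apply pow_lt, z | exact w0]).
  assert (hb : INR (k * M + 0) = INR k * INR M /\ INR (k * b + 1) = INR k * INR b + 1)
    by (rewrite !plus_INR, !mult_INR; simpl; lra).
  destruct hb as [hb1 hb2].
  assert (hk' := below (k * M + 0)%nat (k * b + 1)%nat).
  rewrite hb1, hb2, h in hk'.
  assert (hln : INR k * ln (Zmn w M b) + ln (w 0%nat) <= ln (Zmn w (k * M + 0) (k * b + 1))).
  { rewrite <- ln_pow, <- ln_mult by (try apply pow_lt; assumption).
    apply ln_le; assumption. }
  assert (hk2 := hk' ltac:(lra) ltac:(nra)).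
  apply (Rmult_le_compat_r e) in hk; [|lra].
  rewrite Rmult_plus_distr_r in hk; unfold Rdiv in hk.
  rewrite Rmult_assoc, Rinv_l in hk by lra.
  assert (ke : INR k * e = INR k * ln (Zmn w M b) - INR k * INR b * g)
    by (unfold e; ring).
  lra. }
apply (Hg theta); intros K.
set (q := exp (g + lam * theta)).
apply (le_of_pow_le_linear _ q K).
{ apply cond_pos_sum; intros k.
  apply Rmult_le_pos; [apply w_ge0 | apply pow_le, Rlt_le, exp_pos]. }
{ apply exp_pos. }
intros b; eapply Rle_trans; [apply pow_partial_sum_le; [exact w_ge0 | apply Rlt_le, exp_pos]|].
rewrite Rmult_comm, <- sum_cte; apply sum_Rle; intros M _.
destruct (Rle_lt_or_eq_dec _ _ (Zmn_ge0 w w_ge0 M b)) as [z|<-].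
- specialize (all M b z).
  rewrite <- (exp_ln _ z) at 1; unfold q; rewrite !exp_pow, <- exp_plus.
  apply exp_monotone; lra.
- rewrite Rmult_0_l; apply pow_le, Rlt_le, exp_pos.
Qed.

(* Most of the boxes are filled with copies of the two configurations of a straddling
   pair, mixed in proportions realising the mean [lam]; a small fraction [kappa] of the
   boxes is kept to reach the exact total [m]. *)
Lemma Zmn_exp_lower w d lam g s :
  weight_seq w -> 0 < w 0%nat -> is_span w d ->
  0 < lam -> lam < INR s -> 0 < w s ->
  (forall theta,
     ~ forall K, sum_f_R0 (fun k => w k * exp theta ^ k) K <= exp (g + lam * theta)) ->
  forall eps, 0 < eps -> exists eta, exists N : nat, 0 < eta /\
    forall n m : nat, (N <= n)%nat -> Rabs (INR m - lam * INR n) <= eta * INR n ->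
      Nat.divide d m -> exp ((g - eps) * INR n) <= Zmn w m n.
Proof.
intros w_ge0 w0 dspan lam0 lams ws Hg eps eps0.
destruct (Zmn_exp_lower_crude w d lam s w_ge0 w0 dspan lam0 lams ws)
  as [c0 [eta0 [N0 [c00 [eta00 crude]]]]].
destruct (exists_straddling_pair w lam g s w_ge0 w0 lam0 lams ws Hg)
  as [M1 [b1 [M2 [b2 [z1 [z2 [h1 [h2 pos]]]]]]]].
set (A := lam * INR b1 - INR M1) in *.
set (D := INR M2 - lam * INR b2) in *.
set (l1 := ln (Zmn w M1 b1) - INR b1 * g) in *.
set (l2 := ln (Zmn w M2 b2) - INR b2 * g) in *.
assert (A0 : 0 < A) by (unfold A; lra).
assert (D0 : 0 < D) by (unfold D; lra).
pose proof (pos_INR b1) as b1p; pose proof (pos_INR b2) as b2p.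
pose proof (pos_INR M1) as M1p.
assert (b10 : 0 < INR b1) by (unfold A in A0; nra).
(* Boxes used per copy of the first configuration, whose deficit [A] is balanced by [A / D] copies
   of the second. *)
set (beta := INR b1 + INR b2 * (A / D)).
assert (AD : 0 < A / D) by (apply Rdiv_lt_0_compat; assumption).
assert (beta0 : 0 < beta) by (unfold beta; nra).
set (C := Rabs (ln c0)); set (G := Rabs g + C + 1).
assert (C0 : 0 <= C) by apply Rabs_pos.
assert (G0 : 1 <= G) by (unfold G; pose proof (Rabs_pos g); lra).
(* In the exponent, each reserved box costs at most [G]: the rate [g] not earned there, and the
   crude bound [c0]. *)
set (kap := Rmin (1 / 2) (eps / (2 * G))).
assert (kap0 : 0 < kap).
{ unfold kap; apply Rmin_case; [lra | apply Rdiv_lt_0_compat; lra]. }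
assert (kap1 : kap <= 1 / 2) by apply Rmin_l.
assert (kapG : G * kap <= eps / 2).
{ apply Rle_trans with (G * (eps / (2 * G))).
  - apply Rmult_le_compat_l; [lra | apply Rmin_r].
  - apply Req_le; field; lra. }
set (cst := Rabs l2 + G * (beta + INR b2)).
destruct (nat_above (2 * D / (eta0 * kap))) as [N1 hN1].
destruct (nat_above (INR N0 / kap)) as [N2 hN2].
destruct (nat_above (2 * cst / eps)) as [N3 hN3].
(* The first bound leaves enough balls for the mixture; the second keeps the remainder within [eta0]
   of the mean, although only [kap * n] boxes are guaranteed for it. Half of that margin is left for
   the rounding error [D]. *)
exists (Rmin (lam * kap) (eta0 * kap / 2)), (N1 + N2 + N3)%nat.
split; [apply Rmin_case; nra|].
intros n m hn hm dm.
assert (hnR : INR N1 <= INR n /\ INR N2 <= INR n /\ INR N3 <= INR n)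
  by (repeat split; apply le_INR; lia).
destruct hnR as [hn1 [hn2 hn3]].
pose proof (pos_INR n) as n0.
assert (n1 : 2 * D <= eta0 * kap * INR n).
{ apply (Rmult_le_compat_l (eta0 * kap)) in hN1; [|nra].
  replace (eta0 * kap * (2 * D / (eta0 * kap))) with (2 * D) in hN1 by (field; lra).
  assert (0 < eta0 * kap) by nra. nra. }
assert (n2 : INR N0 <= kap * INR n).
{ apply (Rmult_le_compat_l kap) in hN2; [|lra].
  replace (kap * (INR N0 / kap)) with (INR N0) in hN2 by (field; lra). nra. }
assert (n3 : cst <= eps / 2 * INR n).
{ apply (Rmult_le_compat_l (eps / 2)) in hN3; [|lra].
  replace (eps / 2 * (2 * cst / eps)) with cst in hN3 by (field; lra). nra. }
assert (hm1 : Rabs (INR m - lam * INR n) <= lam * kap * INR n).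
{ eapply Rle_trans; [exact hm|]; apply Rmult_le_compat_r; [exact n0 | apply Rmin_l]. }
assert (hm2 : Rabs (INR m - lam * INR n) <= eta0 * kap / 2 * INR n).
{ eapply Rle_trans; [exact hm|]; apply Rmult_le_compat_r; [exact n0 | apply Rmin_r]. }
destruct (nat_floor ((1 - kap) * INR n / beta)) as [a1 [a1l a1u]].
{ apply Rmult_le_pos; [nra | apply Rlt_le, Rinv_0_lt_compat, beta0]. }
destruct (nat_floor (INR a1 * (A / D))) as [a2 [a2l a2u]].
{ apply Rmult_le_pos; [apply pos_INR | lra]. }
pose proof (pos_INR a1) as a1p; pose proof (pos_INR a2) as a2p.
assert (a1l' : INR a1 * beta <= (1 - kap) * INR n).
{ apply (Rmult_le_compat_r beta) in a1l; [|lra].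
  unfold Rdiv in a1l; rewrite (Rmult_assoc _ (/ beta)), Rinv_l in a1l; lra. }
assert (a1u' : (1 - kap) * INR n < INR a1 * beta + beta).
{ apply (Rmult_lt_compat_r beta) in a1u; [|lra].
  unfold Rdiv in a1u; rewrite (Rmult_assoc _ (/ beta)), Rinv_l in a1u; lra. }
assert (a2l' : INR a2 * D <= INR a1 * A).
{ apply (Rmult_le_compat_r D) in a2l; [|lra].
  replace (INR a1 * (A / D) * D) with (INR a1 * A) in a2l by (field; lra); lra. }
assert (a2u' : INR a1 * A < INR a2 * D + D).
{ apply (Rmult_lt_compat_r D) in a2u; [|lra].
  replace (INR a1 * (A / D) * D) with (INR a1 * A) in a2u by (field; lra); lra. }
set (n0' := (a1 * b1 + a2 * b2)%nat); set (m0' := (a1 * M1 + a2 * M2)%nat).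
assert (en0 : INR n0' = INR a1 * INR b1 + INR a2 * INR b2)
  by (unfold n0'; rewrite plus_INR, !mult_INR; ring).
assert (em0 : INR m0' = INR a1 * INR M1 + INR a2 * INR M2)
  by (unfold m0'; rewrite plus_INR, !mult_INR; ring).
assert (drift : INR m0' - lam * INR n0' = INR a2 * D - INR a1 * A)
  by (rewrite en0, em0; unfold A, D; ring).
assert (n0up : INR n0' <= (1 - kap) * INR n).
{ eapply Rle_trans; [|exact a1l']; rewrite en0; unfold beta.
  apply (Rmult_le_compat_r (INR b2)) in a2l; lra. }
assert (n0low : (1 - kap) * INR n - beta - INR b2 <= INR n0').
{ rewrite en0; unfold beta in *.
  apply Rlt_le, (fun h => Rmult_le_compat_r (INR b2) _ _ b2p h) in a2u; lra. }
assert (nle : (n0' <= n)%nat) by (apply INR_le; nra).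
assert (mle : (m0' <= m)%nat).
{ apply INR_le; apply Rabs_le_between in hm1; nra. }
assert (rest : c0 ^ (n - n0') <= Zmn w (m - m0') (n - n0')).
{ apply crude.
  - apply INR_le; rewrite minus_INR by exact nle; lra.
  - rewrite !minus_INR by assumption.
    replace (INR m - INR m0' - lam * (INR n - INR n0'))
      with ((INR m - lam * INR n) - (INR m0' - lam * INR n0')) by ring.
    rewrite drift.
    apply Rabs_le_between in hm2; apply Rabs_le_between.
    assert (eta0 * (kap * INR n) <= eta0 * (INR n - INR n0'))
      by (apply Rmult_le_compat_l; lra).
    split; lra.
  - apply Nat.divide_sub_r; [exact dm|].
    destruct dspan as [_ [dw _]].
    apply Nat.divide_add_r; apply Nat.divide_mul_r;
      [apply (Zmn_divide w w_ge0 d M1 b1) | apply (Zmn_divide w w_ge0 d M2 b2)];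
      assumption. }
assert (main : Zmn w M1 b1 ^ a1 * Zmn w M2 b2 ^ a2 * c0 ^ (n - n0') <= Zmn w m n).
{ replace n with (n0' + (n - n0'))%nat at 2 by lia.
  replace m with (m0' + (m - m0'))%nat by lia.
  eapply Rle_trans; [|apply Zmn_supermul, w_ge0].
  replace (m0' + (m - m0') - m0')%nat with (m - m0')%nat by lia.
  apply Rmult_le_compat; [| apply pow_le; lra | | exact rest].
  - apply Rmult_le_pos; apply pow_le; lra.
  - eapply Rle_trans; [|apply Zmn_supermul, w_ge0].
    apply Rmult_le_compat; try (apply pow_le; lra); apply Zmn_pow_le, w_ge0. }
eapply Rle_trans; [|exact main].
rewrite <- (exp_ln _ z1), <- (exp_ln _ z2), <- (exp_ln _ c00), !exp_pow, <- !exp_plus.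
apply exp_monotone.
rewrite minus_INR by exact nle.
assert (e12 : INR a1 * ln (Zmn w M1 b1) + INR a2 * ln (Zmn w M2 b2)
              = INR n0' * g + (INR a1 * l1 + INR a2 * l2))
  by (rewrite en0; unfold l1, l2; ring).
rewrite e12.
(* The balanced mixture has nonnegative excess by the choice of the pair; rounding [a2] down loses
   less than one copy of the second configuration. *)
assert (mix : - Rabs l2 <= INR a1 * l1 + INR a2 * l2).
{ apply Rmult_le_reg_r with D; [exact D0|].
  replace ((INR a1 * l1 + INR a2 * l2) * D)
    with (INR a1 * (l1 * D + l2 * A) + l2 * (INR a2 * D - INR a1 * A)) by ring.
  assert (0 <= INR a1 * (l1 * D + l2 * A)) by (apply Rmult_le_pos; lra).
  assert (- Rabs l2 * D <= l2 * (INR a2 * D - INR a1 * A)).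
  { unfold Rabs; destruct (Rcase_abs l2); nra. }
  lra. }
set (r := INR n - INR n0') in *.
assert (r0 : 0 <= r) by (unfold r; nra).
assert (ru : r <= kap * INR n + beta + INR b2) by (unfold r; lra).
assert (lnc : - C * r <= r * ln c0).
{ unfold C, Rabs; destruct (Rcase_abs (ln c0)); nra. }
assert (gr : - (Rabs g * r) <= - (g * r)).
{ pose proof (Rle_abs g); nra. }
assert (Gr : (Rabs g + C) * r <= G * r) by (apply Rmult_le_compat_r; unfold G; lra).
assert (Gr2 : G * r <= G * (kap * INR n + beta + INR b2)) by (apply Rmult_le_compat_l; lra).
assert (Gk : G * kap * INR n <= eps / 2 * INR n) by (apply Rmult_le_compat_r; lra).
replace (INR n0' * g) with (INR n * g - g * r) by (unfold r; ring).
unfold cst in n3; lra.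
Qed.

(** The tangent to the exponential at the tilted mean [lam'] gives Phi(e^theta) >= Phi(tau) e^(sg
    lam') with [sg] = theta - ln tau. If [lam' = lam], this contradicts the choice of [g]. Otherwise
    it forces [sg > 0], that is e^theta > tau, where the partial sums are unbounded. *)
Lemma partial_sums_not_below_tangent w lam lam' tau Phi_tau g :
  weight_seq w -> 0 < tau -> 0 < Phi_tau ->
  is_series (fun k => w k * tau ^ k) Phi_tau ->
  is_series (fun k => INR k * (w k * tau ^ k)) (lam' * Phi_tau) ->
  (lam' = lam \/
   lam' <= lam /\ forall t, tau < t ->
     ~ exists B, forall K, sum_f_R0 (fun k => w k * t ^ k) K <= B) ->
  exp g < Phi_tau * exp (- (lam * ln tau)) ->
  forall theta,
    ~ forall K, sum_f_R0 (fun k => w k * exp theta ^ k) K <= exp (g + lam * theta).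
Proof.
intros w_ge0 tau0 Phi0 sPhi sMean hlam hg theta H.
set (sg := theta - ln tau).
assert (lower : exp (sg * lam') * Phi_tau <= exp (g + lam * theta)).
{ set (e := exp (sg * lam')).
  assert (lim : is_series (fun k => e * (1 - sg * lam') * (w k * tau ^ k)
                           + e * sg * (INR k * (w k * tau ^ k))) (e * Phi_tau)).
  { pose proof (is_series_scal_l (V := R_NormedModule)
    (e * (1 - sg * lam') : R_AbsRing) _ _ sPhi) as h1.
  pose proof (is_series_scal_l (V := R_NormedModule) (e * sg : R_AbsRing) _ _ sMean) as h2.
  pose proof (is_series_plus _ _ _ _ h1 h2) as h3.
  replace (e * Phi_tau) with
    (e * (1 - sg * lam') * Phi_tau + e * sg * (lam' * Phi_tau)) by ring.
  exact h3. }
  apply (is_lim_seq_le (sum_n (fun k => e * (1 - sg * lam') * (w k * tau ^ k)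
                           + e * sg * (INR k * (w k * tau ^ k))))
           (fun _ => exp (g + lam * theta)) (e * Phi_tau) (exp (g + lam * theta)));
    [| exact lim | apply is_lim_seq_const].
  intros K; eapply Rle_trans; [|apply (H K)].
  rewrite sum_n_Reals; apply sum_Rle; intros k _.
  replace (exp theta ^ k) with (tau ^ k * exp (sg * INR k)).
  - replace (sg * INR k) with (sg * lam' + sg * (INR k - lam')) by ring.
    rewrite exp_plus; fold e.
    pose proof (exp_ineq1_le (sg * (INR k - lam'))) as he.
    replace (w k * (tau ^ k * (e * exp (sg * (INR k - lam')))))
      with (e * (w k * tau ^ k) * exp (sg * (INR k - lam'))) by ring.
    eapply Rle_trans; [|apply Rmult_le_compat_l; [|exact he]].
    + apply Req_le; ring.
    + apply Rmult_le_pos; [apply Rlt_le, exp_pos|].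
      apply Rmult_le_pos; [apply w_ge0 | apply pow_le; lra].
  - rewrite <- (exp_ln tau tau0) at 1; rewrite !exp_pow, <- exp_plus.
    f_equal; unfold sg; ring. }
rewrite exp_plus in lower.
assert (lt : exp (sg * lam') < exp (sg * lam)).
{ apply Rmult_lt_reg_r with Phi_tau; [exact Phi0|].
  eapply Rle_lt_trans; [exact lower|].
  replace (sg * lam) with (- (lam * ln tau) + lam * theta) by (unfold sg; ring).
  rewrite exp_plus.
  apply (Rmult_lt_compat_r (exp (lam * theta))) in hg; [|apply exp_pos]. lra. }
apply exp_lt_inv in lt.
destruct hlam as [->|[hle nbound]]; [lra|].
assert (sg0 : 0 < sg) by nra.
apply (nbound (exp theta)).
- rewrite <- (exp_ln tau tau0); apply exp_increasing; unfold sg in sg0; lra.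
- eexists; exact H.
Qed.

(** * Phi, Psi and nu up to the radius of convergence *)

Section GeneratingFunction.
Variable w : nat -> R.
Hypothesis w_ge0 : weight_seq w.

Lemma weight_term_ge0 t k : 0 <= t -> 0 <= w k * t ^ k.
Proof. intros t0; apply Rmult_le_pos; [apply w_ge0 | apply pow_le, t0]. Qed.

Lemma bounded_partial_sums_le_radius t B : 0 <= t ->
  (forall K, sum_f_R0 (fun k => w k * t ^ k) K <= B) -> Rbar_le t (CV_radius w).
Proof.
intros t0 hB; apply (proj1 (CV_radius_bounded w)); exists B; intros k.
rewrite Rabs_pos_eq by now apply weight_term_ge0.
eapply Rle_trans; [|apply (hB k)].
apply (sum_f_R0_term_le (fun k => w k * t ^ k)); [|apply Nat.le_refl].
intros i; now apply weight_term_ge0.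
Qed.

Lemma ex_series_bounded (a : nat -> R) B :
  (forall k, 0 <= a k) -> (forall K, sum_f_R0 a K <= B) -> ex_series a.
Proof.
intros a0 hB; destruct (ex_finite_lim_seq_incr (sum_n a) B) as [l hl].
- intros n; rewrite !sum_n_Reals; simpl; pose proof (a0 (S n)); lra.
- intros n; rewrite sum_n_Reals; apply hB.
- now exists l.
Qed.

Lemma partial_sum_le_series (a : nat -> R) l K :
  (forall k, 0 <= a k) -> is_series a l -> sum_f_R0 a K <= l.
Proof.
intros a0 ha; rewrite <- sum_n_Reals.
apply (is_lim_seq_incr_compare (sum_n a) l ha).
intros n; rewrite !sum_n_Reals; simpl; pose proof (a0 (S n)); lra.
Qed.

Lemma is_series_Phi t : ex_series (fun k => w k * t ^ k) ->
  is_series (fun k => w k * t ^ k) (Phi w t).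
Proof. apply Series_correct. Qed.

Lemma Phi_pos t : 0 < w 0%nat -> 0 <= t ->
  ex_series (fun k => w k * t ^ k) -> 0 < Phi w t.
Proof.
intros w0 t0 ht; eapply Rlt_le_trans;
  [|apply (partial_sum_le_series _ _ 0 (fun k => weight_term_ge0 t k t0) (is_series_Phi t ht))].
simpl; lra.
Qed.

Lemma is_series_mean_shift t (l : R) :
  is_series (fun k => INR (S k) * w (S k) * t ^ k) l ->
  is_series (fun k => INR k * (w k * t ^ k)) (t * l).
Proof.
intros h; set (a := fun k => INR k * (w k * t ^ k)).
assert (ha : forall k, t * (INR (S k) * w (S k) * t ^ k) = a (S k))
  by (intros k; unfold a; simpl pow; ring).
pose proof (is_series_scal_l (V := R_NormedModule) (t : R_AbsRing) _ _ h) as h'.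
apply (is_series_ext _ _ _ ha) in h'.
apply (is_series_decr_1 a).
match goal with |- is_series _ ?x => replace x with (t * l) end; [exact h'|].
unfold a, plus, opp; simpl; ring.
Qed.

Lemma inside_radius_ex_series t :
  Rbar_lt (Rabs t) (CV_radius w) -> ex_series (fun k => w k * t ^ k).
Proof. intros h; apply CV_radius_inside in h; now apply ex_pseries_R. Qed.

Lemma is_series_mean t : Rbar_lt (Rabs t) (CV_radius w) ->
  is_series (fun k => INR k * (w k * t ^ k)) (t * Derive (Phi w) t).
Proof.
intros ht; apply is_series_mean_shift.
unfold Phi; rewrite Derive_PSeries by exact ht.
apply Series_correct, ex_pseries_R, ex_pseries_derive, ht.
Qed.

(** Markov's inequality: the mass beyond index [K] is at least [Phi_a - C], and each of its terms
    carries a factor larger than [K]. *)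
Lemma mean_lower (a : nat -> R) K (C Phi_a mean_a : R) :
  (forall k, 0 <= a k) -> sum_f_R0 a K <= C ->
  is_series a Phi_a -> is_series (fun k => INR k * a k) mean_a ->
  INR K * (Phi_a - C) <= mean_a.
Proof.
intros a0 hC sPhi sMean.
assert (part : forall n, INR K * (sum_f_R0 a n - C) <= sum_f_R0 (fun k => INR k * a k) n).
{ pose proof (pos_INR K) as K0.
  assert (pos : forall n, 0 <= sum_f_R0 (fun k => INR k * a k) n).
  { intros n; apply cond_pos_sum; intros k; apply Rmult_le_pos; [apply pos_INR | apply a0]. }
  assert (small : forall n, (n <= K)%nat ->
            INR K * (sum_f_R0 a n - C) <= sum_f_R0 (fun k => INR k * a k) n).
  { intros n hn; apply Rle_trans with 0; [|apply pos].
    pose proof (sum_f_R0_incr a n K a0 hn); nra. }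
  induction n as [|n IH]; [apply small; lia|].
  destruct (Nat.le_gt_cases (S n) K) as [h|h]; [now apply small|].
  rewrite !tech5.
  assert (INR K * a (S n) <= INR (S n) * a (S n))
    by (apply Rmult_le_compat_r; [apply a0 | apply le_INR; lia]).
  lra. }
assert (lim : is_lim_seq (fun n => INR K * (sum_n a n - C)) (INR K * (Phi_a - C))).
{ apply (is_lim_seq_scal_l _ (INR K) (Finite (Phi_a - C))).
  apply is_lim_seq_minus'; [exact sPhi | apply is_lim_seq_const]. }
apply (is_lim_seq_le _ _ (Finite _) (Finite mean_a)) with (2 := lim) (3 := sMean).
intros n; rewrite !sum_n_Reals; apply part.
Qed.

Lemma continuity_partial_sum N r :
  continuity_pt (fun t => sum_f_R0 (fun k => w k * t ^ k) N) r.
Proof.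
induction N as [|N IH]; simpl sum_f_R0.
- apply continuity_pt_const; intros x y; reflexivity.
- apply (continuity_pt_plus _ (fun t => w (S N) * t ^ (S N))); [exact IH|].
  apply (continuity_pt_scal (fun t => t ^ (S N))).
  apply derivable_continuous_pt, derivable_pt_pow.
Qed.

(** Once Phi(t) exceeds twice the bound [C] on the first terms, more than half of the tilted mass
    lies beyond [K], so its mean exceeds K/2. Hence nu is infinite whenever Phi(rho) is. *)
Lemma Psi_at_left_infinite r : 0 < w 0%nat -> 0 < r -> CV_radius w = Finite r ->
  ~ ex_series (fun k => w k * r ^ k) ->
  filterlim (Psi w) (at_left r) (Rbar_locally p_infty).
Proof.
intros w0 r0 hr nex P [M hM].
destruct (nat_above (2 * Rmax M 0 + 1)) as [K hK].
pose proof (Rmax_l M 0) as M1; pose proof (Rmax_r M 0) as M2.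
set (C := sum_f_R0 (fun k => w k * r ^ k) K).
assert (C0 : 0 <= C)
  by (apply cond_pos_sum; intros k; apply weight_term_ge0; lra).
assert (exists N, 2 * C + 1 < sum_f_R0 (fun k => w k * r ^ k) N) as [N hN].
{ apply NNPP; intros hno; apply nex, (ex_series_bounded _ (2 * C + 1)).
  - intros k; apply weight_term_ge0; lra.
  - intros N; apply Rnot_lt_le; intros h; apply hno; now exists N. }
pose proof (continuity_partial_sum N r) as cont.
apply continuity_pt_filterlim in cont.
assert (near1 : locally r (fun t => 2 * C + 1 < sum_f_R0 (fun k => w k * t ^ k) N))
  by (apply cont, (open_gt (2 * C + 1)), hN).
assert (near2 : locally r (fun t => 0 < t)) by (apply (open_gt 0), r0).
unfold filtermap, at_left, within.
generalize (filter_and _ _ near1 near2); apply filter_imp.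
intros t [ht t0] tr; apply hM.
assert (hrad : Rbar_lt (Rabs t) (CV_radius w))
  by (rewrite hr, Rabs_pos_eq; simpl; lra).
assert (tpos : forall k, 0 <= w k * t ^ k) by (intros k; apply weight_term_ge0; lra).
pose proof (is_series_Phi t (inside_radius_ex_series t hrad)) as sPhi.
pose proof (is_series_mean t hrad) as sMean.
assert (big := partial_sum_le_series _ _ N tpos sPhi).
assert (hC : sum_f_R0 (fun k => w k * t ^ k) K <= C).
{ apply sum_Rle; intros k _; apply Rmult_le_compat_l; [apply w_ge0|].
  apply pow_incr; lra. }
pose proof (mean_lower _ K C _ _ tpos hC sPhi sMean) as hmean.
rewrite Psi_E; apply Rmult_lt_reg_r with (Phi w t); [lra|].
unfold Rdiv; rewrite (Rmult_assoc _ (/ _)), Rinv_l, Rmult_1_r by lra.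
eapply Rlt_le_trans; [|exact hmean].
apply Rle_lt_trans with (Rmax M 0 * Phi w t); [apply Rmult_le_compat_r; lra|].
apply Rlt_le_trans with ((2 * Rmax M 0 + 1) * (Phi w t - C));
  [nra | apply Rmult_le_compat_r; lra].
Qed.

Lemma nu_w_finite_radius r : CV_radius w = Finite r ->
  nu_w w = if excluded_middle_informative (ex_series (fun k => w k * r ^ k))
           then Rbar_mult (Rbar_mult r
                  (Lim_seq (sum_n (fun k => INR (S k) * w (S k) * r ^ k)))) (/ Phi w r)
           else Rbar_lim_along (at_left r) (Psi w).
Proof.
intros hr; unfold nu_w, rho_w; rewrite hr.
repeat match goal with |- context [excluded_middle_informative ?P] =>
  destruct (excluded_middle_informative P) end; try reflexivity; contradiction.
Qed.

Lemma nu_finite_ex_series r lam : 0 < w 0%nat -> 0 < r -> CV_radius w = Finite r ->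
  Rbar_le (nu_w w) (Finite lam) -> ex_series (fun k => w k * r ^ k).
Proof.
intros w0 r0 hr hnu; rewrite (nu_w_finite_radius r hr) in hnu.
destruct (excluded_middle_informative _) as [|nex]; [assumption | exfalso].
pose proof (Psi_at_left_infinite r w0 r0 hr nex) as lim.
(* The value chosen by [epsilon] is known to be a limit only because some limit exists. If it were
   at most [lam], [Psi] would be both below and above [lam + 1] near [r]. *)
pose proof (epsilon_spec (inhabits p_infty)
  (fun l => filterlim (Psi w) (at_left r) (Rbar_locally l))
  (ex_intro _ p_infty lim)) as spec.
fold (Rbar_lim_along (at_left r) (Psi w)) in spec.
assert (up : at_left r (fun t => Psi w t < lam + 1)).
{ apply (spec (fun x => x < lam + 1)).
  destruct (Rbar_lim_along (at_left r) (Psi w)) as [l| |]; simpl in hnu |- *.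
  - apply (open_lt (lam + 1)); lra.
  - contradiction.
  - exists (lam + 1); auto. }
assert (down : at_left r (fun t => lam + 1 < Psi w t))
  by (apply (lim (fun x => lam + 1 < x)); exists (lam + 1); auto).
destruct (filter_ex (F := at_left r) _ (filter_and _ _ up down)) as [t ht]; lra.
Qed.

(** A finite upper bound on nu excludes divergence of Phi and of Phi' at the radius, so the law
    tilted at the radius itself exists and has mean nu. *)
Lemma nu_at_radius r lam : 0 < w 0%nat -> 0 < r -> CV_radius w = Finite r ->
  Rbar_le (nu_w w) (Finite lam) ->
  exists lam', nu_w w = Finite lam' /\
    is_series (fun k => w k * r ^ k) (Phi w r) /\ 0 < Phi w r /\
    is_series (fun k => INR k * (w k * r ^ k)) (lam' * Phi w r).
Proof.
intros w0 r0 hr hnu.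
pose proof (nu_finite_ex_series r lam w0 r0 hr hnu) as ex.
assert (r0' : 0 <= r) by lra.
pose proof (Phi_pos r w0 r0' ex) as Phi0.
pose proof (is_series_Phi r ex) as sPhi.
rewrite (nu_w_finite_radius r hr) in *.
destruct (excluded_middle_informative _) as [ex'|nex]; [|contradiction].
set (u := sum_n (fun k => INR (S k) * w (S k) * r ^ k)).
assert (term0 : forall k, 0 <= INR (S k) * w (S k) * r ^ k).
{ intros k; apply Rmult_le_pos; [|apply pow_le; lra].
  apply Rmult_le_pos; [apply pos_INR | apply w_ge0]. }
assert (uincr : forall n, u n <= u (S n)).
{ intros n; unfold u; rewrite !sum_n_Reals, tech5; pose proof (term0 (S n)); lra. }
pose proof (Lim_seq_correct u (ex_lim_seq_incr u uincr)) as hlim.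
fold u in hnu |- *.
assert (u0 : Rbar_le 0 (Lim_seq u)).
{ apply (is_lim_seq_le (fun _ => 0) u); [|apply is_lim_seq_const | exact hlim].
  intros n; unfold u; rewrite sum_n_Reals; now apply cond_pos_sum. }
assert (iPhi : 0 < / Phi w r) by now apply Rinv_0_lt_compat.
destruct (Lim_seq u) as [L| |]; [|exfalso|contradiction].
- exists (r * L * / Phi w r); repeat split; try assumption.
  replace (r * L * / Phi w r * Phi w r) with (r * L) by (field; lra).
  apply is_series_mean_shift, hlim.
- rewrite (is_Rbar_mult_unique (Finite r) p_infty p_infty) in hnu.
  + rewrite (is_Rbar_mult_unique p_infty (Finite (/ Phi w r)) p_infty) in hnu; [exact hnu|].
    apply is_Rbar_mult_p_infty_pos; exact iPhi.
  + apply is_Rbar_mult_sym, is_Rbar_mult_p_infty_pos; exact r0.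
Qed.

Lemma Psi_0 : Psi w 0 = 0.
Proof. rewrite Psi_E; unfold Rdiv; ring. Qed.

(* The last alternative is the case [tau = rho], where [lam'] is [nu]. *)
Lemma tilted_mean lam tau :
  0 < w 0%nat -> 0 < lam -> 0 <= tau ->
  Rbar_le (Finite tau) (rho_w w) ->
  (Rbar_le (Finite lam) (nu_w w) -> Psi_ext w tau = Finite lam) ->
  (Rbar_lt (nu_w w) (Finite lam) -> Finite tau = rho_w w) ->
  Rbar_lt (Finite 0) (rho_w w) ->
  exists lam', 0 < tau /\ 0 < Phi w tau /\
    is_series (fun k => w k * tau ^ k) (Phi w tau) /\
    is_series (fun k => INR k * (w k * tau ^ k)) (lam' * Phi w tau) /\
    (lam' = lam \/
     lam' <= lam /\ forall t, tau < t ->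
       ~ exists B, forall K, sum_f_R0 (fun k => w k * t ^ k) K <= B).
Proof.
intros w0 lam0 tau0 tau_rho hle hlt rho0.
assert (boundary : forall lam', Finite tau = rho_w w -> Rbar_le (nu_w w) (Finite lam) ->
  nu_w w = Finite lam' -> 0 < tau /\ 0 < Phi w tau /\
    is_series (fun k => w k * tau ^ k) (Phi w tau) /\
    is_series (fun k => INR k * (w k * tau ^ k)) (lam' * Phi w tau)).
{ intros lam' htau hnu enu.
  assert (tpos : 0 < tau) by (rewrite <- htau in rho0; exact rho0).
  destruct (nu_at_radius tau lam w0 tpos (eq_sym htau) hnu) as [l [el [h1 [h2 h3]]]].
  rewrite enu in el; injection el as <-; auto. }
destruct (Rbar_le_lt_dec (Finite lam) (nu_w w)) as [h|h].
- specialize (hle h); exists lam; unfold Psi_ext in hle.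
  destruct (Rbar_lt_dec (Finite tau) (rho_w w)) as [htau|htau].
  + injection hle as hPsi.
    assert (hrad : Rbar_lt (Rabs tau) (CV_radius w)) by (rewrite Rabs_pos_eq; assumption).
    assert (tpos : 0 < tau).
    { destruct (Rle_lt_or_eq_dec _ _ tau0) as [|e]; [assumption|].
      rewrite <- e, Psi_0 in hPsi; lra. }
    pose proof (inside_radius_ex_series tau hrad) as ex.
    pose proof (Phi_pos tau w0 tau0 ex) as Phi0.
    repeat split; auto; [now apply is_series_Phi|].
    replace (lam * Phi w tau) with (tau * Derive (Phi w) tau)
      by (rewrite <- hPsi, Psi_E; field; lra).
    now apply is_series_mean.
  (* Now [tau] = rho, where [Psi_ext] returns nu; so nu = [lam] and the boundary law has the right
     mean. *)
  + change (nu_w w = Finite lam) in hle.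
    assert (htau' : Finite tau = rho_w w)
      by (apply Rbar_le_antisym; [exact tau_rho | now apply Rbar_not_lt_le]).
    assert (hnu : Rbar_le (nu_w w) (Finite lam)) by (rewrite hle; apply Rle_refl).
    destruct (boundary lam htau' hnu hle) as [h1 [h2 [h3 h4]]].
    repeat split; auto.
- specialize (hlt h).
  assert (hnu : Rbar_le (nu_w w) (Finite lam)) by now apply Rbar_lt_le.
  assert (tpos : 0 < tau) by (rewrite <- hlt in rho0; exact rho0).
  destruct (nu_at_radius tau lam w0 tpos (eq_sym hlt) hnu) as [lam' [el _]].
  destruct (boundary lam' hlt hnu el) as [h1 [h2 [h3 h4]]].
  exists lam'; repeat split; auto; right; split.
  + rewrite el in hnu; exact hnu.
  + intros t ht [B hB].
    assert (Rbar_le t (CV_radius w)) as hrad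
      by (apply bounded_partial_sums_le_radius with B; [lra | exact hB]).
    unfold rho_w in hlt; rewrite <- hlt in hrad; simpl in hrad; lra.
Qed.

End GeneratingFunction.

(** * Exponential size of Z(m,n) for m near lambda n *)

Lemma Zw_of_nat w m n : Zw w (Z.of_nat m) n = Zmn w m n.
Proof.
unfold Zw; destruct (Z.ltb_spec (Z.of_nat m) 0) as [h|_]; [lia|].
now rewrite Nat2Z.id.
Qed.

Lemma Zw_neg w m n : (m < 0)%Z -> Zw w m n = 0.
Proof. intros h; unfold Zw; now rewrite (proj2 (Z.ltb_lt m 0) h). Qed.

Lemma Zw_pos_of_nat w m n : 0 < Zw w m n -> exists m' : nat, m = Z.of_nat m'.
Proof.
intros h; destruct (Z.lt_ge_cases m 0) as [neg|pos].
- rewrite Zw_neg in h; [lra | exact neg].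
- exists (Z.to_nat m); now rewrite Z2Nat.id.
Qed.

Lemma Zmn_near_exponential w d lam s tau Phi_tau :
  weight_seq w -> 0 < w 0%nat -> is_span w d ->
  0 < lam -> lam < INR s -> 0 < w s -> 0 < tau -> 0 < Phi_tau ->
  (forall g, exp g < Phi_tau * exp (- (lam * ln tau)) -> forall theta,
     ~ forall K, sum_f_R0 (fun k => w k * exp theta ^ k) K <= exp (g + lam * theta)) ->
  forall eps, 0 < eps -> exists eta, exists N : nat, 0 < eta /\
    forall n m : nat, (N <= n)%nat -> Rabs (INR m - lam * INR n) <= eta * INR n ->
      0 < Zmn w m n -> Phi_tau ^ n <= exp (eps * INR n) * (Zmn w m n * tau ^ m).
Proof.
intros w_ge0 w0 dspan lam0 lams ws tau0 Phi0 Hg eps eps0.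
(* Three losses of at most [eps / 4] per box: [g] below its critical value, the lower bound on Z,
   and the passage from tau^(lam n) to tau^m. *)
set (g := ln Phi_tau - lam * ln tau - eps / 4).
assert (hg : exp g < Phi_tau * exp (- (lam * ln tau))).
{ rewrite <- (exp_ln Phi_tau Phi0) at 1; rewrite <- exp_plus.
  apply exp_increasing; unfold g; lra. }
destruct (Zmn_exp_lower w d lam g s w_ge0 w0 dspan lam0 lams ws (Hg g hg) (eps / 4))
  as [eta [N [eta0 lower]]]; [lra|].
pose proof (Rabs_pos (ln tau)) as L0.
set (c := eps / (4 * (Rabs (ln tau) + 1))).
assert (c0 : 0 < c) by (apply Rdiv_lt_0_compat; lra).
exists (Rmin eta c), N; split; [now apply Rmin_case|].
intros n m hn hm z0.
pose proof (pos_INR n) as n0.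
assert (hm1 : Rabs (INR m - lam * INR n) <= eta * INR n)
  by (eapply Rle_trans; [exact hm | apply Rmult_le_compat_r; [exact n0 | apply Rmin_l]]).
assert (hm2 : Rabs (INR m - lam * INR n) <= c * INR n)
  by (eapply Rle_trans; [exact hm | apply Rmult_le_compat_r; [exact n0 | apply Rmin_r]]).
assert (dm : Nat.divide d m)
  by (destruct dspan as [_ [dw _]]; now apply (Zmn_divide w w_ge0 d m n)).
pose proof (lower n m hn hm1 dm) as hz.
eapply Rle_trans; [|apply Rmult_le_compat_l; [apply Rlt_le, exp_pos|];
  apply Rmult_le_compat_r; [apply pow_le; lra | exact hz]].
rewrite <- (exp_ln Phi_tau Phi0) at 1; rewrite <- (exp_ln tau tau0) at 1.
rewrite !exp_pow, <- !exp_plus; apply exp_monotone.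
assert (drift : - (c * INR n * Rabs (ln tau)) <= (INR m - lam * INR n) * ln tau).
{ apply Rle_trans with (- Rabs ((INR m - lam * INR n) * ln tau)).
  - rewrite Rabs_mult; apply Ropp_le_contravar, Rmult_le_compat_r; [exact L0 | exact hm2].
  - pose proof (Rle_abs (- ((INR m - lam * INR n) * ln tau))) as h.
    rewrite Rabs_Ropp in h; lra. }
assert (cL : c * Rabs (ln tau) <= eps / 4).
{ apply Rle_trans with (c * (Rabs (ln tau) + 1)); [nra|].
  apply Req_le; unfold c; field; lra. }
apply (Rmult_le_compat_r (INR n)) in cL; [|exact n0].
unfold g; nra.
Qed.

Lemma exp_le_quadratic s : Rabs s <= 1 / 2 -> exp s <= 1 + s + 2 * s ^ 2.
Proof.
intros hs; apply Rabs_le_between in hs.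
pose proof (exp_ineq1_le (- s)) as h; pose proof (exp_pos s) as e0.
apply (Rmult_le_compat_l (exp s)) in h; [|lra].
rewrite <- exp_plus, Rplus_opp_r, exp_0 in h.
apply Rmult_le_reg_r with (1 + - s); [lra | nra].
Qed.

(** A filter over pairs rather than a sequence m(n): limits along it can be composed with shifts of
    m and of n. Positivity of Z is built in, so each shift has to preserve it. *)
Definition near_mean (w : nat -> R) (lam : R) (P : Z * nat -> Prop) : Prop :=
  exists dl, exists N : nat, 0 < dl /\ forall (m : Z) (n : nat), (N <= n)%nat ->
    Rabs (IZR m - lam * INR n) <= dl * INR n -> 0 < Zw w m n -> P (m, n).

Global Instance near_mean_filter w lam : Filter (near_mean w lam).
Proof.
split.
- exists 1, 0%nat; split; [lra | auto].
- intros P Q [d1 [N1 [h1 H1]]] [d2 [N2 [h2 H2]]].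
  exists (Rmin d1 d2), (N1 + N2)%nat; split; [now apply Rmin_case|].
  intros m n hn hm z; pose proof (pos_INR n).
  split; [apply H1 | apply H2]; try assumption; try lia;
    (eapply Rle_trans; [exact hm|]; apply Rmult_le_compat_r; [assumption|]);
    [apply Rmin_l | apply Rmin_r].
- intros P Q hPQ [dl [N [h H]]]; exists dl, N; split; [exact h|].
  intros m n hn hm z; apply hPQ; now apply H.
Qed.

Lemma near_mean_pos w lam : near_mean w lam (fun p => 0 < Zw w (fst p) (snd p)).
Proof. exists 1, 0%nat; split; [lra | auto]. Qed.

Lemma filterlim_Rmult {T} {F : (T -> Prop) -> Prop} {FF : Filter F} (f g : T -> R) a b :
  filterlim f F (locally a) -> filterlim g F (locally b) ->
  filterlim (fun x => f x * g x) F (locally (a * b)).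
Proof.
intros hf hg; apply (filterlim_comp_2 f g Rmult hf hg).
apply (filterlim_mult (K := R_AbsRing) a b).
Qed.

Lemma filterlim_Rinv_ne0 {T} {F : (T -> Prop) -> Prop} {FF : Filter F} (f : T -> R) a :
  a <> 0 -> filterlim f F (locally a) -> filterlim (fun x => / f x) F (locally (/ a)).
Proof.
intros a0 hf; eapply filterlim_comp; [exact hf|].
apply (filterlim_Rbar_inv (Finite a)); congruence.
Qed.

Lemma filterlim_pos {T} {F : (T -> Prop) -> Prop} {FF : Filter F} (f : T -> R) a :
  0 < a -> filterlim f F (locally a) -> F (fun x => 0 < f x).
Proof. intros a0 hf; apply (hf (fun y => 0 < y)), (open_gt 0), a0. Qed.

(** * From occupation proportions to ratios of Z *)

Section Ratios.
Variables (w : nat -> R) (lam tau Phi_tau : R).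
Hypotheses (w_ge0 : weight_seq w) (w0 : 0 < w 0%nat) (tau0 : 0 < tau) (Phi0 : 0 < Phi_tau).
Hypothesis partial_sums : forall K, sum_f_R0 (fun k => w k * tau ^ k) K <= Phi_tau.
Hypothesis near_exponential : forall eps, 0 < eps -> exists eta, exists N : nat, 0 < eta /\
    forall n m : nat, (N <= n)%nat -> Rabs (INR m - lam * INR n) <= eta * INR n ->
      0 < Zmn w m n -> Phi_tau ^ n <= exp (eps * INR n) * (Zmn w m n * tau ^ m).

Lemma mean_occupancy_lim j :
  filterlim (fun p => w j * Zw w (fst p - Z.of_nat j) (snd p - 1) / Zw w (fst p) (snd p))
    (near_mean w lam) (locally (w j * tau ^ j / Phi_tau)).
Proof.
apply filterlim_locally; intros [eps eps0]; simpl.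
set (pi := w j * tau ^ j / Phi_tau).
assert (pi0 : 0 <= pi).
{ apply Rmult_le_pos; [|apply Rlt_le, Rinv_0_lt_compat, Phi0].
  apply weight_term_ge0; [exact w_ge0 | lra]. }
set (sg := Rmin (1 / 2) (eps / (4 * (pi + 1)))).
assert (sg0 : 0 < sg) by (apply Rmin_case; [lra | apply Rdiv_lt_0_compat; lra]).
assert (sg1 : sg <= 1 / 2) by apply Rmin_l.
assert (sgpi : sg * pi <= eps / 4).
{ apply Rle_trans with (sg * (pi + 1)); [nra|].
  apply Rle_trans with (eps / (4 * (pi + 1)) * (pi + 1)).
  - apply Rmult_le_compat_r; [lra | apply Rmin_r].
  - apply Req_le; field; lra. }
(* The tilt [sg] is fixed before the exponential error is chosen; after division by [sg] that error
   is [eps / 4], and the quadratic term contributes at most [eps / 2]. *)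
destruct (near_exponential (sg * (eps / 4))) as [eta [N [eta0 lower]]]; [nra|].
exists eta, (S N); split; [exact eta0|].
intros m n hn hm z0; simpl in z0 |- *.
destruct (Zw_pos_of_nat w m n z0) as [m' ->].
rewrite <- INR_IZR_INZ in hm; rewrite Zw_of_nat in z0 |- *.
specialize (lower n m' ltac:(lia) hm z0).
set (x := w j * Zw w (Z.of_nat m' - Z.of_nat j) (n - 1) / Zmn w m' n).
assert (n0 : 0 < INR n) by (apply lt_0_INR; lia).
assert (occ : occupancy w j m' n / Zmn w m' n = INR n * x).
{ unfold occupancy, x; destruct (Nat.leb_spec j m') as [h|h].
  - rewrite <- Nat2Z.inj_sub, Zw_of_nat by exact h; field; lra.
  - rewrite Zw_neg by lia; field; lra. }
assert (tilt : forall s, Rabs s <= 1 / 2 ->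
          s * x <= (s + 2 * s ^ 2) * pi + sg * (eps / 4)).
{ intros s hs.
  pose proof (occupancy_chernoff w j s tau Phi_tau m' n w_ge0 ltac:(lra) Phi0
                partial_sums z0) as ch.
  rewrite occ in ch; fold pi in ch.
  set (y := Zmn w m' n * tau ^ m') in *.
  assert (y0 : 0 < y) by (apply Rmult_lt_0_compat; [exact z0 | apply pow_lt, tau0]).
  assert (e : exp (s * (INR n * x))
              <= exp (sg * (eps / 4) * INR n + INR n * ((exp s - 1) * pi))).
  { apply Rmult_le_reg_r with y; [exact y0|].
    eapply Rle_trans; [exact ch|].
    apply (Rmult_le_compat_r (exp (INR n * ((exp s - 1) * pi)))) in lower;
      [|apply Rlt_le, exp_pos].
    rewrite exp_plus; lra. }
  assert (e' : s * (INR n * x) <= sg * (eps / 4) * INR n + INR n * ((exp s - 1) * pi)).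
  { apply Rnot_lt_le; intros h; apply exp_increasing in h; lra. }
  assert (e2 : s * x <= (exp s - 1) * pi + sg * (eps / 4)).
  { apply Rmult_le_reg_l with (INR n); [exact n0 | lra]. }
  pose proof (exp_le_quadratic s hs) as q.
  assert ((exp s - 1) * pi <= (s + 2 * s ^ 2) * pi)
    by (apply Rmult_le_compat_r; lra).
  lra. }
(* Opposite tilts bound the same proportion from above and from below. *)
pose proof (tilt sg ltac:(rewrite Rabs_pos_eq; lra)) as t1.
pose proof (tilt (- sg) ltac:(rewrite Rabs_Ropp, Rabs_pos_eq; lra)) as t2.
assert (up : x <= pi + 2 * (sg * pi) + eps / 4)
  by (apply Rmult_le_reg_l with sg; [exact sg0 | lra]).
assert (low : pi - 2 * (sg * pi) - eps / 4 <= x)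
  by (apply Rmult_le_reg_l with sg; [exact sg0 | lra]).
change (Rabs (x - pi) < eps).
apply Rabs_def1; lra.
Qed.

Lemma shrunk_ratio_lim j : 0 < w j ->
  filterlim (fun p => Zw w (fst p - Z.of_nat j) (snd p - 1) / Zw w (fst p) (snd p))
    (near_mean w lam) (locally (tau ^ j / Phi_tau)).
Proof.
intros wj; pose proof (mean_occupancy_lim j) as h.
apply (filterlim_ext (fun p => / w j *
  (w j * Zw w (fst p - Z.of_nat j) (snd p - 1) / Zw w (fst p) (snd p)))).
- intros p; unfold Rdiv; rewrite <- !Rmult_assoc, Rinv_l, Rmult_1_l; lra.
- replace (tau ^ j / Phi_tau) with (/ w j * (w j * tau ^ j / Phi_tau)) by (field; lra).
  apply filterlim_Rmult; [apply filterlim_const | exact h].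
Qed.

Lemma Zw_supermul_pos m1 n1 (k : nat) : 0 < w k -> 0 < Zw w m1 n1 ->
  0 < Zw w (m1 + Z.of_nat k) (S n1).
Proof.
intros wk z; destruct (Zw_pos_of_nat w m1 n1 z) as [m ->].
rewrite <- Nat2Z.inj_add, Zw_of_nat in *.
replace (S n1) with (n1 + 1)%nat by lia.
eapply Rlt_le_trans; [|apply Zmn_supermul, w_ge0].
rewrite Zmn_1; now apply Rmult_lt_0_compat.
Qed.

(** An added empty box keeps Z positive. Evaluating the occupation limits at n + 1 boxes turns their
    n - 1 into n. *)
Lemma near_mean_shift_boxes :
  filterlim (fun p : Z * nat => (fst p, S (snd p))) (near_mean w lam) (near_mean w lam).
Proof.
intros P [dl [N [dl0 H]]].
destruct (nat_above (2 * Rabs lam / dl)) as [N1 hN1].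
exists (dl / 2), (N + N1)%nat; split; [lra|].
intros m n hn hm z; simpl; apply H; [lia | |].
- assert (INR N1 <= INR n) by (apply le_INR; lia).
  apply (Rmult_le_compat_l (dl / 2)) in hN1; [|lra].
  replace (dl / 2 * (2 * Rabs lam / dl)) with (Rabs lam) in hN1 by (field; lra).
  rewrite S_INR.
  replace (IZR m - lam * (INR n + 1)) with ((IZR m - lam * INR n) + - lam) by ring.
  eapply Rle_trans; [apply Rabs_triang|]; rewrite Rabs_Ropp; nra.
- replace m with (m + Z.of_nat 0)%Z by lia; now apply Zw_supermul_pos.
Qed.

Lemma near_mean_shift_balls (k : Z) :
  near_mean w lam (fun p => 0 < Zw w (fst p + k) (snd p)) ->
  filterlim (fun p : Z * nat => ((fst p + k)%Z, snd p)) (near_mean w lam) (near_mean w lam).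
Proof.
intros [d1 [N1 [d10 H1]]] P [dl [N [dl0 H]]].
destruct (nat_above (2 * Rabs (IZR k) / dl)) as [N2 hN2].
exists (Rmin d1 (dl / 2)), (N + N1 + N2)%nat; split; [apply Rmin_case; lra|].
intros m n hn hm z; simpl; pose proof (pos_INR n) as n0; apply H; [lia | |].
- assert (INR N2 <= INR n) by (apply le_INR; lia).
  apply (Rmult_le_compat_l (dl / 2)) in hN2; [|lra].
  replace (dl / 2 * (2 * Rabs (IZR k) / dl)) with (Rabs (IZR k)) in hN2 by (field; lra).
  assert (Rabs (IZR m - lam * INR n) <= dl / 2 * INR n).
  { eapply Rle_trans; [exact hm|]; apply Rmult_le_compat_r; [exact n0 | apply Rmin_r]. }
  rewrite plus_IZR.
  replace (IZR m + IZR k - lam * INR n) with ((IZR m - lam * INR n) + IZR k) by ring.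
  eapply Rle_trans; [apply Rabs_triang|]; nra.
- apply (H1 m n); [lia | | exact z].
  eapply Rle_trans; [exact hm|]; apply Rmult_le_compat_r; [exact n0 | apply Rmin_l].
Qed.

Definition ratio_lim (k : Z) : Prop :=
  filterlim (fun p => Zw w (fst p + k) (snd p) / Zw w (fst p) (snd p))
    (near_mean w lam) (locally (powerRZ tau (- k))).

(** The limit is positive, so the shifted Z is eventually positive: the hypothesis that
    [near_mean_shift_balls] needs. *)
Lemma ratio_lim_pos k : ratio_lim k ->
  near_mean w lam (fun p => 0 < Zw w (fst p + k) (snd p)).
Proof.
intros h.
assert (pos := filterlim_pos _ _ (powerRZ_lt tau (- k) tau0) h).
generalize (filter_and _ _ pos (near_mean_pos w lam)); apply filter_imp.
intros p [hq hd].
replace (Zw w (fst p + k) (snd p))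
  with (Zw w (fst p + k) (snd p) / Zw w (fst p) (snd p) * Zw w (fst p) (snd p))
  by (field; lra).
now apply Rmult_lt_0_compat.
Qed.

Lemma ratio_lim_add a b : ratio_lim a -> ratio_lim b -> ratio_lim (a + b).
Proof.
intros ha hb; pose proof (ratio_lim_pos a ha) as pos.
pose proof (filterlim_comp _ _ _ _ _ _ _ _ (near_mean_shift_balls a pos) hb) as hb'.
unfold ratio_lim; rewrite Z.opp_add_distr, powerRZ_add by lra.
eapply filterlim_ext_loc; [|exact (filterlim_Rmult _ _ _ _ ha hb')].
generalize (filter_and _ _ pos (near_mean_pos w lam)); apply filter_imp.
intros p [h1 h2]; simpl; rewrite Z.add_assoc; field; lra.
Qed.

Lemma ratio_lim_opp_support j : 0 < w j -> ratio_lim (- Z.of_nat j).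
Proof.
intros wj; unfold ratio_lim.
assert (i0 : 1 / Phi_tau <> 0).
{ apply Rgt_not_eq, Rdiv_lt_0_compat; lra. }
pose proof (filterlim_Rmult _ _ _ _ (shrunk_ratio_lim j wj)
  (filterlim_Rinv_ne0 _ _ i0 (shrunk_ratio_lim 0 w0))) as h.
pose proof (filterlim_comp _ _ _ _ _ _ _ _ near_mean_shift_boxes h) as h'.
replace (powerRZ tau (- - Z.of_nat j)) with (tau ^ j / Phi_tau * / (1 / Phi_tau)).
- eapply filterlim_ext_loc; [|exact h'].
  generalize (near_mean_pos w lam); apply filter_imp; intros p hp; simpl.
  rewrite Nat.sub_0_r, Z.sub_0_r.
  assert (0 < Zw w (fst p) (S (snd p))).
  { replace (fst p) with (fst p + Z.of_nat 0)%Z by lia; now apply Zw_supermul_pos. }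
  change (fst p + - Z.of_nat j)%Z with (fst p - Z.of_nat j)%Z.
  field; lra.
- rewrite Z.opp_involutive, <- pow_powerRZ; field; lra.
Qed.

Lemma ratio_lim_support j : 0 < w j -> ratio_lim (Z.of_nat j).
Proof.
intros wj.
(* Positivity must precede the inversion of the negative shift. The occupation limit for empty boxes
   gives Z(m,n-1) > 0, and a box with [j] balls is added. *)
assert (pos : near_mean w lam (fun p => 0 < Zw w (fst p + Z.of_nat j) (snd p))).
{ assert (i0 : 0 < tau ^ 0 / Phi_tau) by (apply Rdiv_lt_0_compat; simpl; lra).
  assert (pos := filterlim_pos _ _ i0 (shrunk_ratio_lim 0 w0)).
  destruct (filter_and _ _ pos (near_mean_pos w lam)) as [dl [N [dl0 H]]].
  exists dl, (S N); split; [exact dl0|].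
  intros m n hn hm z; destruct (H m n ltac:(lia) hm z) as [h _]; simpl in h |- *.
  rewrite Z.sub_0_r in h.
  replace n with (S (n - 1)) by lia; apply Zw_supermul_pos; [exact wj|].
  apply (Rmult_lt_compat_r (Zw w m n)) in h; [|exact z].
  unfold Rdiv in h; rewrite Rmult_assoc, Rinv_l in h; lra. }
pose proof (filterlim_comp _ _ _ _ _ _ _ _ (near_mean_shift_balls _ pos)
  (ratio_lim_opp_support j wj)) as h.
assert (t0 : powerRZ tau (- - Z.of_nat j) <> 0)
  by (apply Rgt_not_eq, powerRZ_lt, tau0).
apply filterlim_Rinv_ne0 in h; [|exact t0].
unfold ratio_lim; rewrite (powerRZ_neg' tau (Z.of_nat j)).
rewrite Z.opp_involutive in h.
eapply filterlim_ext_loc; [|exact h].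
generalize (filter_and _ _ pos (near_mean_pos w lam)); apply filter_imp.
intros p [h1 h2]; simpl.
replace (fst p + Z.of_nat j + - Z.of_nat j)%Z with (fst p) by lia.
field; lra.
Qed.

Lemma ratio_lim_span d : is_span w d -> (exists k, (1 <= k)%nat /\ 0 < w k) ->
  forall k, (Z.of_nat d | k)%Z -> ratio_lim k.
Proof.
intros dspan wk k hk.
(* Both signs are carried along, so that closure under differences follows from closure under
   sums. *)
apply (span_multiple_in_subgroup w d (fun k => ratio_lim k /\ ratio_lim (- k)) dspan wk);
  [| |exact hk].
- intros j wj; split; [now apply ratio_lim_support | now apply ratio_lim_opp_support].
- intros a b [ha ha'] [hb hb']; split.
  + now apply ratio_lim_add.
  + replace (- (a - b))%Z with (- a + b)%Z by lia; now apply ratio_lim_add.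
Qed.

End Ratios.

Lemma below_omega_support w lam : Rbar_lt (Finite lam) (omega_w w) ->
  exists s : nat, lam < INR s /\ 0 < w s.
Proof.
intros h; apply NNPP; intros hno; apply (Rbar_lt_not_le _ _ h).
apply (proj2 (Lub_Rbar_correct (fun x => exists k : nat, x = INR k /\ 0 < w k))).
intros x [k [-> wk]]; simpl; apply Rnot_lt_le; intros hk; apply hno; now exists k.
Qed.

Theorem theorem17p8 (w : nat -> R) (m : nat -> nat) (lambda tau : R) :
  weight_seq w ->
  (0 < w 0%nat)%R ->
  (exists k : nat, (1 <= k)%nat /\ (0 < w k)%R) ->
  is_lim_seq (fun n => (INR (m n) / INR n)%R) lambda ->
  (0 < lambda)%R ->
  Rbar_lt (Finite lambda) (omega_w w) ->
  (* tau in [0, rho]: Psi(tau) = lambda if lambda <= nu, tau = rho if lambda > nu *)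
  (0 <= tau)%R ->
  Rbar_le (Finite tau) (rho_w w) ->
  (Rbar_le (Finite lambda) (nu_w w) -> Psi_ext w tau = Finite lambda) ->
  (Rbar_lt (nu_w w) (Finite lambda) -> Finite tau = rho_w w) ->
  Rbar_lt (Finite 0) (rho_w w) ->
  forall (d : nat) (k : Z),
    is_span w d ->
    (Z.of_nat d | k)%Z ->
    (* Z(m+k,n)/Z(m,n) -> tau^(-k) along the n with Z(m,n) > 0 *)
    forall eps : R, (0 < eps)%R ->
      exists N : nat, forall n : nat, (N <= n)%nat ->
        (0 < Zw w (Z.of_nat (m n)) n)%R ->
        (Rabs (Zw w (Z.of_nat (m n) + k)%Z n / Zw w (Z.of_nat (m n)) n
               - powerRZ tau (- k)) < eps)%R.
Proof.
intros w_ge0 w0 wk mlim lam0 hom tau_ge0 tau_rho hle hlt rho0 d k dspan dk eps eps0.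
destruct (below_omega_support w lambda hom) as [s [lams ws]].
destruct (tilted_mean w w_ge0 lambda tau w0 lam0 tau_ge0 tau_rho hle hlt rho0)
  as [lam' [tau0 [Phi0 [sPhi [sMean hlam']]]]].
assert (lim : ratio_lim w lambda tau k).
{ apply (ratio_lim_span w lambda tau (Phi w tau) w_ge0 w0 tau0 Phi0)
    with (d := d); try assumption.
  - intros K; apply partial_sum_le_series; [|exact sPhi].
    intros i; now apply weight_term_ge0.
  - apply (Zmn_near_exponential w d lambda s tau); try assumption.
    intros g hg; now apply (partial_sums_not_below_tangent w lambda lam' tau (Phi w tau)). }
apply (proj1 (filterlim_locally _ _)) with (eps := mkposreal eps eps0) in lim.
destruct lim as [dl [N [dl0 H]]].
apply is_lim_seq_spec in mlim; destruct (mlim (mkposreal dl dl0)) as [N1 hN1].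
exists (S (N + N1)); intros n hn z.
assert (n0 : 0 < INR n) by (apply lt_0_INR; lia).
apply (H (Z.of_nat (m n)) n); [lia | | exact z].
rewrite <- INR_IZR_INZ; specialize (hN1 n ltac:(lia)); simpl in hN1.
replace (INR (m n) - lambda * INR n) with ((INR (m n) / INR n - lambda) * INR n)
  by (field; lra).
rewrite Rabs_mult, (Rabs_pos_eq (INR n)) by lra.
apply Rmult_le_compat_r; lra.
Qed.
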